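(* Let $n\ge 6$, $p\ge 2$ and $0\le m\le 1$ be integers such that $n=2p+2+m$. Then $$ex_{\mathcal{P}}(n,\{K_4,\Theta_6^1\})=\left\lfloor \tfrac{5}{2}(n-2)\right\rfloor,$$ and the graph $2K_1+(pK_2\cup mK_1)$ is an extremal graph, i.e. it is a $\{K_4,\Theta_6^1\}$-free planar graph on $n$ vertices with exactly $\left\lfloor \tfrac{5}{2}(n-2)\right\rfloor$ edges.
   Context: All graphs are simple, finite and undirected. $\Theta_6^1$ is the graph obtained from a cycle $C_6$ by adding an edge joining two vertices at distance $3$ on the cycle (equivalently, two cycles of length $4$ sharing exactly one edge and its two endpoints). For a family $\mathcal{H}$ of graphs, a graph is $\mathcal{H}$-free if it contains no subgraph (not necessarily induced) isomorphic to a member of $\mathcal{H}$. The planar Turán number $ex_{\mathcal{P}}(n,\mathcal{H})$ is the maximum number of edges in an $\mathcal{H}$-free planar graph on $n$ vertices. For vertex-disjoint graphs $H_1,H_2$, $H_1\cup H_2$ is their disjoint union, and $H_1+H_2$ is their join (the disjoint union together with all edges between $V(H_1)$ and $V(H_2)$). $tH$ denotes the disjoint union of $t$ copies of $H$. *)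

(* Defs.v *)
From HB Require Import structures.
From mathcomp Require Import all_boot all_order all_algebra.
From mathcomp Require Import all_classical all_reals all_analysis.
Import Order.TTheory GRing.Theory Num.Theory.
Import numFieldNormedType.Exports.

Set Implicit Arguments.
Unset Strict Implicit.
Unset Printing Implicit Defensive.

Record sgraph := SGraph {
  vertex :> finType;
  adj : rel vertex;
  adj_sym : symmetric adj;
  adj_irrefl : irreflexive adj }.

Definition edges (G : sgraph) : {set {set G}} :=
  [set E : {set G} | [exists x, [exists y, adj x y && (E == [set x; y]%SET)]]]%SET.

Definition nb_edges (G : sgraph) : nat := #|edges G|.

Section CompleteGraph.
Variable n : nat.

Definition complete_adj : rel 'I_n := fun x y => x != y.

Lemma complete_adj_sym : symmetric complete_adj.
Proof. by move=> x y; rewrite /complete_adj eq_sym. Qed.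

Lemma complete_adj_irrefl : irreflexive complete_adj.
Proof. by move=> x; rewrite /complete_adj eqxx. Qed.

Definition complete_graph : sgraph :=
  SGraph complete_adj_sym complete_adj_irrefl.

End CompleteGraph.

(* The cycle 0 1 2 3 4 5 together with the chord {0, 3}; [ordS] is the
   successor modulo 6. *)
Definition theta6_adj : rel 'I_6 := fun x y =>
  [|| y == ordS x, x == ordS y,
      (x == 0 :> nat) && (y == 3 :> nat) | (x == 3 :> nat) && (y == 0 :> nat)].

Lemma theta6_adj_sym : symmetric theta6_adj.
Proof.
move=> x y; rewrite /theta6_adj orbCA; do 2!congr (_ || _).
by rewrite orbC; congr (_ || _); exact: andbC.
Qed.

Lemma theta6_adj_irrefl : irreflexive theta6_adj.
Proof. by case; do 6?[case=> //]. Qed.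

Definition theta6 : sgraph := SGraph theta6_adj_sym theta6_adj_irrefl.

Section SumGraph.
Variables (b : bool) (G H : sgraph).

(* [b] tells whether the two parts are completely joined to each other. *)
Definition sum_adj : rel (G + H)%type := fun u v =>
  match u, v with
  | inl x, inl y => adj x y
  | inr x, inr y => adj x y
  | _, _ => b
  end.

Lemma sum_adj_sym : symmetric sum_adj.
Proof. by case=> x [y|y] //=; rewrite adj_sym. Qed.

Lemma sum_adj_irrefl : irreflexive sum_adj.
Proof. by case=> x /=; rewrite adj_irrefl. Qed.

Definition sum_graph : sgraph := SGraph sum_adj_sym sum_adj_irrefl.

End SumGraph.

Definition disjoint_union (G H : sgraph) : sgraph := sum_graph false G H.

Definition join (G H : sgraph) : sgraph := sum_graph true G H.

Section Copies.
Variables (t : nat) (G : sgraph).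

Definition copies_adj : rel ('I_t * G)%type := fun u v =>
  (u.1 == v.1) && adj u.2 v.2.

Lemma copies_adj_sym : symmetric copies_adj.
Proof. by move=> u v; rewrite /copies_adj eq_sym adj_sym. Qed.

Lemma copies_adj_irrefl : irreflexive copies_adj.
Proof. by move=> u; rewrite /copies_adj adj_irrefl andbF. Qed.

Definition copies : sgraph := SGraph copies_adj_sym copies_adj_irrefl.

End Copies.

Definition contains (G H : sgraph) : Prop :=
  exists f : H -> G, injective f /\ forall x y, adj x y -> adj (f x) (f y).

Definition free_of (F : sgraph -> Prop) (G : sgraph) : Prop :=
  forall H, F H -> ~ contains G H.

Section Planarity.
Local Open Scope classical_set_scope.
Local Open Scope ring_scope.
Variables (R : realType) (G : sgraph).

Definition is_arc (gamma : R -> R * R) (a b : R * R) : Prop :=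
  [/\ {within `[0, 1], continuous gamma},
      {in `[0, 1] &, injective gamma}, gamma 0 = a & gamma 1 = b].

(* [arc x y] is only constrained when [adj x y]. Since an edge {x, y} appears
   with both orientations, [arc y x] is [arc x y] traversed backwards. *)
Definition is_plane_drawing
    (pos : G -> R * R) (arc : G -> G -> R -> R * R) : Prop :=
  [/\ injective pos,
      forall x y, adj x y -> is_arc (arc x y) (pos x) (pos y),
      forall x y, adj x y -> forall t : R, t \in `[0, 1] -> arc y x t = arc x y (1 - t),
      forall x y z, adj x y -> forall t : R, t \in `]0, 1[ -> arc x y t <> pos z &
      forall x y x' y', adj x y -> adj x' y' ->
        [set x; y]%SET != [set x'; y']%SET ->
        forall s t : R, s \in `]0, 1[ -> t \in `]0, 1[ -> arc x y s <> arc x' y' t].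

Definition planar : Prop := exists pos arc, is_plane_drawing pos arc.

End Planarity.

(* A graph on n vertices has at most 'C(n, 2) edges, so the bound on the index
   excludes no graph; the maximum is 0 if there is no such graph. *)
Definition ex_planar (R : realType) (n : nat) (F : sgraph -> Prop) : nat :=
  \max_(k < 'C(n, 2).+1 |
        `[< exists G : sgraph, [/\ #|G| = n, planar R G, free_of F G &
                                   nb_edges G = k] >]) k.

(* Main.v *)
Require Import Defs.
From mathcomp Require Import all_boot all_order all_algebra.
From mathcomp Require Import all_classical all_reals all_analysis.
From mathcomp Require Import zify ring lra.
Import Order.TTheory GRing.Theory Num.Theory.
Import numFieldNormedType.Exports.
Import mathcomp.boot.fintype mathcomp.boot.finset.
Set Implicit Arguments.
Unset Strict Implicit.
Unset Printing Implicit Defensive.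

(** The graph 2K_1 + (pK_2 u mK_1) consists of two non-adjacent poles, both
    joined to all vertices of a matching.  It is planar: put the matching on a
    line and one pole on either side of it.  It has 5p + 2m edges.  A copy of
    K_4 or of Theta in it would have to become a matching after the removal of
    at most two pairwise non-adjacent vertices, and neither graph allows that.

    For the upper bound, planarity is used only through a consequence of
    Euler's formula modulo 2, called [face_family] below.  A planar graph with
    n vertices and e edges has at least e - n + 2 faces, each of which is a set
    of edges with even degree at every vertex; each edge lies on at most two
    faces; and no proper nonempty set of faces covers every edge an even number
    of times.  Such a family needs no connectedness of the graph, and it is
    obtained without the Jordan curve theorem.  By compactness, different arcs
    of a plane drawing stay at a positive distance from each other except near
    their common ends, so a fine square grid contains the graph as a minor
    ([planar_grid_parts]).  The grid has faces, namely its cells and the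
    outside ([grid_facial]), and they survive the deletion of an edge, which
    merges two faces, and the contraction of an edge, which merges two vertices
    ([facial_delete], [facial_contract]).

    With f >= e - n + 2 faces, the bound 2e <= 5(n - 2) follows from
    5f <= 3e: the average length of a face is at least 10/3.  (If there are
    fewer than six faces, then e <= n + 3 and the bound holds since n >= 6.)
    Only triangular faces are shorter than that.  Give a face of length k
    the charge 3k - 10: triangles have charge -1, quadrilaterals 2, longer faces
    at least k.  A quadrilateral gives 1/2 and a longer face gives 1 through
    each of its edges.  A triangle glued to at most one other triangle then
    gets at least 1.  If a triangle is glued to two or three others, then,
    since two 4-cycles that share an edge and no further vertex form a Theta, its
    neighbours turn out to receive enough to pass the missing part on to it
    ([fan_rich], [sun_rich], [local_bound]). *)

(** * Sums modulo 2 *)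

Notation "\xor_ ( i | P ) B" := (\big[addb/false]_(i | P) B)
  (at level 34, i name, P at level 100, B at level 39).

Lemma odd_card (T : finType) (A : pred T) : odd #|A| = \xor_(x | A x) true.
Proof.
rewrite -sum1_card (big_morph odd oddD (erefl : odd 0 = false)).
by apply: eq_big => // x.
Qed.

Lemma xor_pick (T : finType) (P : pred T) x0 : \xor_(x | P x) (x0 == x) = P x0.
Proof.
rewrite big_mkcond (bigD1 x0) //= eqxx big1 => [|x nx]; first by rewrite addbF; case: (P x0).
by rewrite eq_sym (negbTE nx) if_same.
Qed.

Lemma andb_xor (T : finType) (P B : pred T) b :
  \xor_(x | P x) (b && B x) = b && \xor_(x | P x) B x.
Proof. by case: b => //=; rewrite big1. Qed.

(** * Faces of a graph that is reduced by deletions and contractions *)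

Definition glue (T : eqType) (a b x : T) := if x == a then b else x.

Lemma glue_eq (T : eqType) (a b : T) : glue a b a = glue a b b.
Proof. by rewrite /glue eqxx; case: eqP. Qed.

Lemma glue_eqE (T : eqType) (a b x f : T) : a != b -> (glue a b x == f) =
  if f == a then false else if f == b then (x == a) (+) (x == b) else x == f.
Proof.
rewrite /glue => nab; have [->{f}|nfa] := eqVneq f a.
  by case: (eqVneq x a) => [_|/negbTE//]; rewrite eq_sym (negbTE nab).
have [->{f nfa}|nfb] := eqVneq f b; have [->|nxa] := eqVneq x a => //.
  by rewrite eqxx (negbTE nab).
by rewrite !(eq_sym _ f) (negbTE nfa) (negbTE nfb).
Qed.

Lemma card_codom_glue (T : finType) (S : finType) (h : S -> T) a b :
  #|codom h| <= #|codom (glue a b \o h)|.+1.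
Proof.
apply: (@leq_trans #|[predU1 a & codom (glue a b \o h)]|).
  apply: subset_leq_card; apply/subsetP => x /codomP[y ->]; rewrite !inE.
  case: eqP => //= /eqP ny; apply/codomP; exists y => /=.
  by rewrite /glue (negbTE ny).
by rewrite cardU1; case: (_ \notin _).
Qed.

(** Edge e joins s e and t e and separates the faces l e and r e.  The maps pi
    and lam send a vertex or a face to the representative of its class after
    some contractions and deletions; A is the set of remaining edges.  The value
    is the parity of the degree of vertex v in the boundary of face f. *)
Definition incidence (V E F : finType) (s t : E -> V) (l r : E -> F)
    (A : {set E}) (pi : V -> V) (lam : F -> F) v f :=
  \xor_(e | e \in A) (((pi (s e) == v) (+) (pi (t e) == v)) &&
                      ((lam (l e) == f) (+) (lam (r e) == f))).

(** Vertices and faces play symmetric roles, so that contraction is the dual of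
    deletion. *)
Lemma incidence_dual (V E F : finType) (s t : E -> V) (l r : E -> F) A pi lam v f :
  incidence s t l r A pi lam v f = incidence l r s t A lam pi f v.
Proof. by apply: eq_bigr => e _; rewrite andbC. Qed.

(** Merging the faces a and b adds their two boundaries modulo 2. *)
Lemma incidence_glue (V E F : finType) (s t : E -> V) (l r : E -> F) A pi lam a b :
  (forall v f, incidence s t l r A pi lam v f = false) ->
  forall v f, incidence s t l r A pi (glue a b \o lam) v f = false.
Proof.
move=> even v f; have [eab|nab] := eqVneq a b.
  rewrite -(even v f); apply: eq_bigr => e _ /=; rewrite /glue eab.
  by do 2!case: (_ =P b) => [->|_].
rewrite /incidence; under eq_bigr => e _ do rewrite /= !(glue_eqE _ _ nab).
have [efa|nfa] := eqVneq f a; first by rewrite big1 // => e _; rewrite andbF.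
have [efb|nfb] := eqVneq f b; last exact: even.
apply: etrans (congr2 addb (even v a) (even v b)).
rewrite /incidence -big_split /=.
by apply: eq_bigr => e _; rewrite -andb_addr addbACA.
Qed.

Section FaceStructure.

Variables (V E F : finType) (s t : E -> V) (l r : E -> F).

(** The third field says that the dual graph is connected: a set of faces that is
    not separated from the others by any edge is empty or contains all faces. *)
Record facial (A : {set E}) (pi : V -> V) (lam : F -> F) : Prop := Facial {
  facial_even : forall v f, incidence s t l r A pi lam v f = false;
  facial_euler : #|A| + 2 <= #|codom lam| + #|codom pi|;
  facial_indep : forall S : pred F, {in A, forall e, S (lam (l e)) = S (lam (r e))} ->
    forall f g, S (lam f) = S (lam g) }.

Lemma incidence_del (A : {set E}) (pi : V -> V) (lam : F -> F) e v f : e \in A ->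
  pi (s e) = pi (t e) \/ lam (l e) = lam (r e) ->
  incidence s t l r A pi lam v f = incidence s t l r (A :\ e) pi lam v f.
Proof.
move=> eA triv; rewrite /incidence (big_setD1 e) //=.
by case: triv => ->; rewrite addbb ?andbF.
Qed.

(** Deleting an edge merges its two sides. *)
Lemma facial_delete (A : {set E}) pi lam e : facial A pi lam -> e \in A ->
  facial (A :\ e) pi (glue (lam (l e)) (lam (r e)) \o lam).
Proof.
move=> [even euler indep] eA; set a := lam (l e); set b := lam (r e).
have lamE : (glue a b \o lam) (l e) = (glue a b \o lam) (r e) by apply: glue_eq.
split=> [v f||S closed f g].
- rewrite -incidence_del //; first exact: incidence_glue.
  by right.
- have := cardsD1 e A; rewrite eA add1n -ltnS -addSn => <-; apply: leq_trans euler _.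
  by rewrite -addSn leq_add2r card_codom_glue.
apply: (indep (S \o glue a b)) => e' e'A /=.
by have [->|ne] := eqVneq e' e; [exact: congr1 lamE|apply: closed; rewrite !inE ne].
Qed.

(** After the contraction of e, a set S of faces that no remaining edge separates
    from the others is not separated by e either: the boundary of S is even at
    the end s e, and it could contain no edge but e. *)
Lemma facial_contract (A : {set E}) pi lam e : facial A pi lam -> e \in A ->
  pi (s e) != pi (t e) ->
  facial (A :\ e) (glue (pi (s e)) (pi (t e)) \o pi) lam.
Proof.
move=> [even euler indep] eA; set a := pi (s e); set b := pi (t e) => nab.
have piE : (glue a b \o pi) (s e) = (glue a b \o pi) (t e) by apply: glue_eq.
split=> [v f||S closed].
- rewrite -incidence_del //; last by left.
  rewrite incidence_dual; apply: incidence_glue => {}f {}v.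
  by rewrite -incidence_dual.
- have := cardsD1 e A; rewrite eA add1n -ltnS -addSn => <-; apply: leq_trans euler _.
  by rewrite -addnS leq_add2l card_codom_glue.
apply: indep => e' e'A.
have [->{e' e'A}|ne] := eqVneq e' e; last by apply: closed; rewrite !inE ne.
have : \xor_(f | S f) incidence s t l r A pi lam a f = false.
  by rewrite big1.
rewrite /incidence exchange_big /= (bigD1 e) //= [X in _ (+) X]big1 ?addbF.
  rewrite andb_xor -/a -/b eqxx (eq_sym b) (negbTE nab) /= big_split /=.
  rewrite !xor_pick.
  by case: (S _); case: (S _).
move=> e' /andP[e'A ne]; rewrite andb_xor big_split /= !xor_pick.
by rewrite (closed e') ?addbb ?andbF // !inE ne.
Qed.

Definition link : rel V := fun u w =>
  [exists e, ((s e == u) && (t e == w)) || ((s e == w) && (t e == u))].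

Lemma linkC : symmetric link.
Proof. by move=> u w; apply: eq_existsb => e; rewrite orbC. Qed.

(** The edges outside C that join two vertices of the same part are contracted as
    long as this merges distinct classes; all other edges outside C are deleted. *)
Lemma facial_minor (W : finType) (own : V -> W) (C : {set E}) :
  facial [set: E] id id -> {in C, forall e, own (s e) != own (t e)} ->
  (forall u w, own u = own w ->
     connect [rel u w | link u w && (own u == own w)] u w) ->
  exists pi lam, facial C pi lam /\ forall u w, (pi u == pi w) = (own u == own w).
Proof.
move=> fac0 Cprop conn.
have [pi [lam [facC fine merged]]] : exists pi lam, [/\ facial C pi lam,
    forall u w, pi u = pi w -> own u = own w
    & forall e, e \notin C -> own (s e) = own (t e) -> pi (s e) = pi (t e)].
  suff gen n A pi lam : #|A :\: C| < n -> C \subset A -> [/\ facial A pi lam,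
      forall u w, pi u = pi w -> own u = own w
      & forall e, e \notin A -> own (s e) = own (t e) -> pi (s e) = pi (t e)] ->
    exists pi lam, [/\ facial C pi lam, forall u w, pi u = pi w -> own u = own w
      & forall e, e \notin C -> own (s e) = own (t e) -> pi (s e) = pi (t e)].
    apply: (gen _ [set: E]%SET id id (ltnSn _) (subsetT C)).
    by split=> // [u w /= -> //|e]; rewrite inE.
  elim: n A pi lam => // n IHn A pi lam; rewrite ltnS => cardA CA [facA fine merged].
  have [eAC|nAC] := eqVneq A C; first by subst A; exists pi, lam; split.
  have /set0Pn[e] : A :\: C != set0.
    by rewrite setD_eq0; apply: contra nAC => sAC; rewrite eqEsubset sAC CA.
  rewrite inE => /andP[eC eA].
  have CAe : C \subset A :\ e.
    apply/subsetP => x xC; rewrite !inE (subsetP CA) // andbT.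
    by apply: contraNneq eC => <-.
  have cardAe : #|A :\ e :\: C| < n.
    apply: leq_trans cardA; rewrite (cardsD1 e (A :\: C)) !inE eC eA add1n ltnS.
    by apply: subset_leq_card; apply/subsetP => x; rewrite !inE andbCA.
  have mergedAe pi' : (forall u w, pi u = pi w -> pi' u = pi' w) ->
      (own (s e) = own (t e) -> pi' (s e) = pi' (t e)) ->
      forall x, x \notin A :\ e -> own (s x) = own (t x) -> pi' (s x) = pi' (t x).
    move=> mono mergee x; rewrite !inE negb_and negbK => /orP[/eqP->|xA] ex.
      exact: mergee.
    by apply/mono/merged.
  have [/eqP eown|nown] := boolP (own (s e) == own (t e)); last first.
    apply: (IHn _ pi _ cardAe CAe); split; [exact: facial_delete facA eA|by []|].
    by apply: mergedAe => // /eqP; rewrite (negbTE nown).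
  have [/eqP epi|npi] := boolP (pi (s e) == pi (t e)).
    apply: (IHn _ pi _ cardAe CAe); split; [exact: facial_delete facA eA|by []|].
    exact: mergedAe.
  apply: (IHn _ _ lam cardAe CAe); split; first exact: facial_contract facA eA npi.
    move=> u w /=; rewrite /glue.
    have [eu|nu] := eqVneq (pi u) (pi (s e)); have [ew|nw] := eqVneq (pi w) (pi (s e)).
    - by move=> _; apply: fine; rewrite eu ew.
    - by rewrite (fine _ _ eu) eown; apply: fine.
    - by rewrite (fine _ _ ew) eown; apply: fine.
    - exact: fine.
  by apply: mergedAe => [u w /= ->|] //= _; apply: glue_eq.
exists pi, lam; split=> // u w; apply/eqP/eqP => [|uw]; first exact: fine.
have /connectP[p] := conn _ _ uw.
elim: p u {uw} => [u _ -> //|x p IHp u /= /andP[/andP[/existsP[e ends] /eqP oux] path_p] ew].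
rewrite -(IHp x) //; move: ends => /orP[]/andP[/eqP su /eqP tu].
  rewrite -su -tu; apply: merged; last by rewrite su tu.
  by apply/negP => /Cprop; rewrite su tu oux eqxx.
rewrite -su -tu; apply/esym/merged; last by rewrite su tu.
by apply/negP => /Cprop; rewrite su tu oux eqxx.
Qed.

End FaceStructure.

(** * Face families of minors *)

(** The consequence of Euler's formula that the upper bound relies on; bd f is the
    boundary of the face f.  Since edges are counted as ordered pairs of adjacent
    vertices, the inequality f >= e - n + 2 is doubled.  By the last clause, no
    linear relation modulo 2 holds between the faces, except possibly that the sum
    of all of them is zero. *)
Definition face_family (W : finType) (adj : rel W) (P : finType) (bd : P -> rel W) :=
  [/\ forall f x y, bd f x y -> adj x y,
      forall f, symmetric (bd f),
      forall f x, ~~ odd #|[pred y | bd f x y]|,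
      forall x y, #|[pred f | bd f x y]| <= 2 &
      (#|[pred p : W * W | adj p.1 p.2]| + 4 <= 2 * #|P| + 2 * #|W|) /\
      (forall S : pred P, (forall x y, ~~ odd #|[pred f | S f && bd f x y]|) ->
         (exists f, S f) -> forall f, S f)].

Section MinorFaces.

Variables (V E F W : finType) (s t : E -> V) (l r : E -> F).
Variables (adj : rel W) (own : V -> W).
Hypothesis adjC : symmetric adj.
Hypothesis adjxx : irreflexive adj.
Hypothesis fac0 : facial s t l r [set: E] id id.
Hypothesis own_surj : forall x, exists u, own u = x.
Hypothesis own_conn : forall u w, own u = own w ->
  connect [rel u w | link s t u w && (own u == own w)] u w.
Hypothesis adj_link : forall x y, adj x y ->
  exists u w, [/\ link s t u w, own u = x & own w = y].

Definition joins (e : E) x y :=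
  ((own (s e) == x) && (own (t e) == y)) || ((own (s e) == y) && (own (t e) == x)).

Definition repr_edge x y := [pick e | joins e x y].

Definition kept := [set e | adj (own (s e)) (own (t e)) &&
                            (repr_edge (own (s e)) (own (t e)) == Some e)].

Lemma joinsC e x y : joins e x y = joins e y x.
Proof. by rewrite /joins orbC. Qed.

Lemma repr_edgeC x y : repr_edge x y = repr_edge y x.
Proof. by apply: eq_pick => e; apply: joinsC. Qed.

Lemma joinsP e x y : joins e x y ->
  (own (s e) = x /\ own (t e) = y) \/ (own (s e) = y /\ own (t e) = x).
Proof. by case/orP => /andP[/eqP-> /eqP->]; [left|right]. Qed.

Lemma repr_edgeP x y : adj x y -> exists2 e, repr_edge x y = Some e & joins e x y.
Proof.
move=> xy; rewrite /repr_edge; case: pickP => [e jxy|no]; first by exists e.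
have [u [w [/existsP[e ends] ou ow]]] := adj_link xy.
have := no e; rewrite /joins -ou -ow.
by case/orP: ends => /andP[/eqP-> /eqP->]; rewrite !eqxx ?orbT.
Qed.

Lemma keptP e x y : joins e x y ->
  (e \in kept) = adj x y && (repr_edge x y == Some e).
Proof.
by rewrite inE => /joinsP[][-> ->] //; rewrite adjC repr_edgeC.
Qed.

Lemma repr_kept x y e : adj x y -> repr_edge x y = Some e -> e \in kept /\ joins e x y.
Proof.
move=> xy re; have [e' re' je] := repr_edgeP xy.
have e'e : e' = e by apply: Some_inj; rewrite -re -re'.
by rewrite -e'e (keptP je) xy re' eqxx.
Qed.

(** A simple graph on the parts keeps one edge of the big graph for each of its
    own edges. *)
Theorem minor_faces : exists (P : finType) (bd : P -> rel W), face_family adj bd.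
Proof.
have kept_neq : {in kept, forall e, own (s e) != own (t e)}.
  by move=> e; rewrite inE => /andP[st _]; apply: contraTneq st => ->; rewrite adjxx.
have [pi [lam [[even euler indep] pi_own]]] := facial_minor fac0 kept_neq own_conn.
pose P : finType := {f : F | f \in codom lam}.
pose sides e f := (lam (l e) == f) (+) (lam (r e) == f).
pose bd (f : P) x y := adj x y && (if repr_edge x y is Some e then sides e (val f) else false).
have bd_joins (f : P) e x y : e \in kept -> joins e x y -> bd f x y = sides e (val f).
  by move=> eK je; move: eK; rewrite (keptP je) /bd => /andP[-> /eqP->].
exists P, bd; split=> [f x y /andP[] //|f x y|f x|x y|].
- by rewrite /bd adjC repr_edgeC.
- have [u oux] := own_surj x; apply/negPf; rewrite odd_card.
  apply: etrans (even (pi u) (val f)).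
  transitivity (\xor_(y | true) \xor_(e | e \in kept) (joins e x y && sides e (val f))).
    rewrite big_mkcond /=; apply: eq_bigr => y _.
    have [xy|nxy] := boolP (adj x y); last first.
      rewrite big1 ?{1}/bd ?(negbTE nxy) // => e eK.
      by apply/negP => /andP[je _]; move: eK; rewrite (keptP je) (negbTE nxy).
    have [e re je] := repr_edgeP xy; have [eK _] := repr_kept xy re.
    rewrite (bd_joins f e) // (bigD1 e) //= je big1 ?addbF => [|e' /andP[e'K ne]].
      by case: (sides e _).
    apply/negP => /andP[je' _]; move: e'K; rewrite (keptP je') re.
    by rewrite (inj_eq Some_inj) eq_sym (negbTE ne) andbF.
  rewrite exchange_big /=.
  apply: eq_bigr => e eK; rewrite !pi_own oux -/(sides e _).
  under eq_bigr do rewrite andbC; rewrite andb_xor andbC; congr (_ && _).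
  have := kept_neq e eK; set a := own (s e); set b := own (t e) => nab.
  rewrite (eq_bigr (fun y => ((a == x) && (b == y)) (+) ((b == x) && (a == y)))).
    by rewrite big_split /= !andb_xor !(xor_pick xpredT) !andbT.
  move=> y _; rewrite /joins -/a -/b.
  case: (eqVneq a x) => [<-|_] /=; last by rewrite andbC.
  by rewrite (eq_sym b a) (negbTE nab) andbF /= orbF addbF.
- rewrite /bd; case: (repr_edge x y) => [e|]; last first.
    by rewrite (eq_card0 (A := [pred f | _])) // => f; rewrite !inE andbF.
  rewrite -(card_imset _ val_inj).
  apply: (@leq_trans #|[set lam (l e); lam (r e)]|); last by rewrite cards2; case: eqP.
  apply: subset_leq_card; apply/subsetP => f /imsetP[g]; rewrite !inE => /andP[_ sg] ->.
  by move: sg; rewrite /sides !(eq_sym _ (val g)); do 2!case: (_ == _).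
- split.
    have cardP : #|P| = #|codom lam| by rewrite card_sig; apply: eq_card.
    have card_pi : #|codom pi| <= #|W|.
      have [sec secK] := fin_all_exists own_surj.
      apply: (@leq_trans #|codom (pi \o sec)|); last exact: leq_image_card.
      apply: subset_leq_card; apply/subsetP => x /codomP[u ->]; apply/codomP.
      by exists (own u); apply/eqP; rewrite /= pi_own secK.
    have card_darts : #|[pred p : W * W | adj p.1 p.2]| <= 2 * #|kept|.
      pose ends (eb : E * bool) := if eb.2 then (own (s eb.1), own (t eb.1))
                                   else (own (t eb.1), own (s eb.1)).
      apply: (@leq_trans #|image ends (setX kept [set: bool])|).
        apply: subset_leq_card; apply/subsetP => -[x y]; rewrite inE /= => xy.
        have [e re je] := repr_edgeP xy; have [eK _] := repr_kept xy re.
        apply/imageP; case/joinsP: je => -[<- <-].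
          by exists (e, true); rewrite ?in_setX ?eK ?in_setT.
        by exists (e, false); rewrite ?in_setX ?eK ?in_setT.
      apply: leq_trans (leq_image_card _ _) _.
      by rewrite cardsX cardsT card_bool mulnC.
    by move: euler card_pi card_darts; rewrite cardP; clear; lia.
move=> S Seven [f0 Sf0] f.
pose S' g := if insub g is Some f then S f else false.
have S'E (h : P) : S' (val h) = S h by rewrite /S' valK.
have closed : {in kept, forall e, S' (lam (l e)) = S' (lam (r e))}.
  move=> e eK; set x := own (s e); set y := own (t e).
  have je : joins e x y by rewrite /joins !eqxx.
  have := Seven x y; rewrite odd_card big_mkcond /=.
  have lP : lam (l e) \in codom lam by apply: codom_f.
  have rP : lam (r e) \in codom lam by apply: codom_f.
  pose in_lam g := is_true (g \in codom lam).
  pose lf : P := exist in_lam _ lP; pose rf : P := exist in_lam _ rP.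
  rewrite (eq_bigr (fun g : P => (S g && (lf == g)) (+) (S g && (rf == g)))).
    have pick_in h : \xor_(g | true) (S g && (h == g)) = S h.
      rewrite -(xor_pick S h) [RHS]big_mkcond; apply: eq_bigr => g _.
      by case: (S g).
    rewrite big_split /= !pick_in -[lam (l e)]/(val lf) -[lam (r e)]/(val rf) !S'E.
    by case: (S lf); case: (S rf).
  move=> g _; rewrite (bd_joins g e x y eK je) -andb_addr /sides.
  by rewrite -!(inj_eq val_inj) /=; case: (S g); case: (_ (+) _).
have [[u fu] [v f0v]] := (codomP (valP f), codomP (valP f0)).
by rewrite -S'E fu (indep S' closed u v) -f0v S'E.
Qed.

End MinorFaces.

(** * Parts covering a connected graph *)

Section Grow.

Variables (V W : finType) (adj : rel V).
Hypothesis adjC : symmetric adj.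
Hypothesis conn : forall u w, connect adj u w.

Definition in_part (p : V -> option W) x : rel V :=
  [rel u w | [&& adj u w, p u == Some x & p w == Some x]].

Definition parts_connected (p : V -> option W) :=
  forall x u w, p u = Some x -> p w = Some x -> connect (in_part p x) u w.

(** A vertex that belongs to no part but has a neighbour in some part can join
    that part. *)
Lemma grow_parts (p : V -> option W) : parts_connected p ->
  (exists u, p u) -> exists own : V -> W,
  (forall u x, p u = Some x -> own u = x) /\
  (forall u w, own u = own w ->
     connect [rel u w | adj u w && (own u == own w)] u w).
Proof.
have [n] := ubnP #|[pred u | ~~ p u]|.
elim: n p => // n IHn p; rewrite ltnS => cardp pconn [u0 pu0].
have [/forallP tot|/forallPn[w0 npw0]] := boolP [forall u, isSome (p u)].
  have [own ownE] : exists own, forall u, p u = Some (own u).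
    by apply: (@fin_all_exists _ (fun=> W) (fun u x => p u = Some x)) => u; have := tot u; case: (p u) => // x _; exists x.
  exists own; split=> [u x|u w]; first by rewrite ownE => -[].
  move=> uw; have := pconn (own u) u w (ownE u) (etrans (ownE w) (congr1 Some (esym uw))).
  apply: connect_sub => a b /and3P[ab]; rewrite !ownE => /eqP[ea] /eqP[eb].
  by apply: connect1; rewrite /= ab ea eb eqxx.
have [u [w [uw pu npw]]] : exists u w, [/\ adj u w, p u & ~~ p w].
  have [/existsP[u /existsP[w /and3P[]]]|no] :=
    boolP [exists u, [exists w, [&& adj u w, isSome (p u) & ~~ p w]]]; first by exists u, w.
  case/negP: npw0; have /connectP[q] := conn u0 w0.
  elim: q u0 pu0 => [u0 pu0 _ -> //|x q IHq u0 pu0 /= /andP[u0x qx] ew].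
  apply: IHq qx ew; apply: contraT => npx; case/negP: no.
  by apply/existsP; exists u0; apply/existsP; exists x; rewrite u0x pu0.
case epu: (p u) pu => [x|] // _.
pose p' z := if z == w then Some x else p z.
have p'old z : p z -> p' z = p z.
  by rewrite /p'; case: eqP => // -> pw; rewrite pw in npw.
have sub y : subrel (connect (in_part p y)) (connect (in_part p' y)).
  apply: connect_sub => a b /and3P[ab /eqP pa /eqP pb]; apply: connect1.
  by rewrite /in_part /= ab !p'old ?pa ?pb ?eqxx.
have p'w : p' w = Some x by rewrite /p' eqxx.
have p'u : p' u = Some x by rewrite p'old ?epu.
have to_u z : p' z = Some x -> connect (in_part p' x) z u.
  have [-> _|nzw] := eqVneq z w; first by apply: connect1; rewrite /in_part /= adjC uw p'w p'u eqxx.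
  by rewrite /p' (negbTE nzw) => pz; apply/sub/pconn.
have symp y : connect_sym (in_part p' y).
  by apply: sym_connect_sym => a b; rewrite /in_part /= adjC [X in _ && X]andbC.
have p'conn : parts_connected p'.
  move=> y a b p'a p'b; have [exy|nxy] := eqVneq x y.
    by subst y; apply: connect_trans (to_u a p'a) _; rewrite symp; apply: to_u.
  have pold z : p' z = Some y -> p z = Some y.
    by rewrite /p'; case: eqP => // _ [exy]; rewrite exy eqxx in nxy.
  by apply/sub/pconn; apply: pold.
have cardp' : #|[pred u | ~~ p' u]| < n.
  apply: leq_trans cardp; apply: proper_card; apply/properP; split.
    by apply/subsetP => z; rewrite !inE /p'; case: eqP.
  by exists w; rewrite !inE // p'w.
have [|own [ownE ownC]] := IHn p' cardp' p'conn; first by exists u; rewrite p'u.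
exists own; split=> // z y pz; apply: ownE; by rewrite p'old pz.
Qed.

End Grow.

(** * The square grid *)

Section Grid.

Variable N : nat.

Definition gvertex := ('I_N.+1 * 'I_N.+1)%type.
Definition gedge := (('I_N * 'I_N.+1) + ('I_N.+1 * 'I_N))%type.
(** None is the outer face. *)
Definition gface := option ('I_N * 'I_N).

Local Notation low := (widen_ord (leqnSn N)).
Local Notation high := (lift ord0).

Definition gsrc (e : gedge) : gvertex :=
  match e with inl (i, j) => (low i, j) | inr (i, j) => (i, low j) end.

Definition gtgt (e : gedge) : gvertex :=
  match e with inl (i, j) => (high i, j) | inr (i, j) => (i, high j) end.

(** The cell with lower left corner (i, j), or the outer face if there is none. *)
Definition cell (i j : nat) : gface :=
  if insub i is Some a then if insub j is Some b then Some (a, b) else None else None.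

Definition gface1 (e : gedge) : gface :=
  match e with inl (i, j) => cell i j | inr (i, j) => cell i j end.

Definition gface2 (e : gedge) : gface :=
  match e with
  | inl (i, j) => if val j is j'.+1 then cell i j' else None
  | inr (i, j) => if val i is i'.+1 then cell i' j else None
  end.

Lemma cell_eq i j (c : 'I_N * 'I_N) :
  (cell i j == Some c) = (i == c.1 :> nat) && (j == c.2 :> nat).
Proof.
case: c => a b; rewrite /cell; case: insubP => [a' _ <-|ni] /=; last first.
  by apply/esym/negP => /andP[/eqP ei _]; rewrite ei ltn_ord in ni.
case: insubP => [b' _ <-|nj] //=; apply/esym/negP => /andP[_ /eqP ej].
by rewrite ej ltn_ord in nj.
Qed.

(** The boundary of a cell consists of two horizontal and two vertical edges. *)
Lemma gsides (e : gedge) (p q : 'I_N) :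
  (gface1 e == Some (p, q)) (+) (gface2 e == Some (p, q)) =
  ((e == inl (p, low q)) (+) (e == inl (p, high q))) (+)
  ((e == inr (low p, q)) (+) (e == inr (high p, q))).
Proof.
case: e => -[i j] /=; rewrite ?addbF ?addFb cell_eq /=.
  rewrite ![inl _ == _]/(_ && _) -!val_eqE /= /bump /= !add1n.
  rewrite ?andbT; case: (nat_of_ord j) => [|j'] /=; rewrite ?cell_eq /= ?eqSS;
    by case: (nat_of_ord i == p); rewrite ?addbF.
rewrite ![inr _ == _]/(_ && _) -!val_eqE /= /bump /= !add1n.
by case: (nat_of_ord i) => [|i'] /=; rewrite ?cell_eq /= ?eqSS.
Qed.

Lemma grid_facial : facial gsrc gtgt gface1 gface2 [set: gedge] id id.
Proof.
have even_cell v c : incidence gsrc gtgt gface1 gface2 [set: gedge] id id v (Some c) = false.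
  case: c => p q; rewrite /incidence.
  pose I e := (gsrc e == v) (+) (gtgt e == v).
  have pick_in e0 : \xor_(e | e \in [set: gedge]) (I e && (e == e0)) = I e0.
    rewrite (bigD1 e0) ?inE //= eqxx andbT big1 ?addbF // => e /andP[_ /negbTE->].
    by rewrite andbF.
  under eq_bigr => e _ do rewrite /= gsides !andb_addr -/(I e).
  rewrite !big_split /= !pick_in /I /=.
  by do 4![case: (_ == v)].
split=> [v [c|]||S closed].
- exact: even_cell.
- (* The boundary of the outer face is the sum of those of the cells. *)
  have : \xor_(f | true) incidence gsrc gtgt gface1 gface2 [set: gedge] id id v f = false.
    rewrite exchange_big big1 //= => e _.
    by rewrite andb_xor big_split /= !(xor_pick xpredT) andbF.
  rewrite (bigD1 None) //= big1 ?addbF // => -[c|] // _; exact: even_cell.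
- rewrite !card_codom // cardsT card_sum !card_prod card_option card_prod !card_ord; lia.
suff to_out c : S (Some c) = S None.
  by move=> [c|] [d|]; rewrite /= ?to_out.
case: c => i [j]; elim: j => [|j IHj] lt_j.
  have := closed (inl (i, ord0)); rewrite inE /= => /(_ isT).
  rewrite (_ : cell _ _ = Some (i, Ordinal lt_j)) => [-> //|].
  by apply/eqP; rewrite cell_eq /= eqxx.
rewrite -(IHj (ltnW lt_j)).
have := closed (inl (i, low (Ordinal lt_j))); rewrite inE /= => /(_ isT).
rewrite (_ : cell i j.+1 = Some (i, Ordinal lt_j)) => [->|].
  by congr S; apply/eqP; rewrite cell_eq /= !eqxx.
by apply/eqP; rewrite cell_eq /= !eqxx.
Qed.

Definition glink : rel gvertex := link gsrc gtgt.

Lemma glinkC : symmetric glink. Proof. exact: linkC. Qed.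

Lemma glink_h (i i' j : 'I_N.+1) : i' = i.+1 :> nat -> glink (i, j) (i', j).
Proof.
move=> ei; have lt_i : i < N by rewrite -ltnS -ei.
apply/existsP; exists (inl (Ordinal lt_i, j)); apply/orP; left.
by rewrite /= !xpair_eqE -!val_eqE /= !eqxx /= ei eqxx.
Qed.

Lemma glink_v (i j j' : 'I_N.+1) : j' = j.+1 :> nat -> glink (i, j) (i, j').
Proof.
move=> ej; have lt_j : j < N by rewrite -ltnS -ej.
apply/existsP; exists (inr (i, Ordinal lt_j)); apply/orP; left.
by rewrite /= !xpair_eqE -!val_eqE /= !eqxx /= ej eqxx.
Qed.

(** The relation B only has to contain the grid edges inside the box, so the lemma
    serves both for the whole grid and for the squares around the vertices. *)
Lemma box_connected (P Q : pred nat) (B : rel gvertex) (u w : gvertex) :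
  (forall i j k, P i -> P k -> i <= j <= k -> P j) ->
  (forall i j k, Q i -> Q k -> i <= j <= k -> Q j) ->
  (forall a b, glink a b -> P a.1 -> Q a.2 -> P b.1 -> Q b.2 -> B a b) ->
  P u.1 -> Q u.2 -> P w.1 -> Q w.2 -> connect B u w.
Proof.
move=> Pconv Qconv BE; case: u w => [i j] [i' j'] /= Pi Qj Pi' Qj'.
apply: (@connect_trans _ _ (i', j)).
  have [n] := ubnP (i - i' + (i' - i)); elim: n i Pi => // n IHn i Pi.
  rewrite ltnS => len; case: (ltngtP i i') => [lt_ii'|gt_ii'|/val_inj->] //.
    have i1N : i.+1 < N.+1 by apply: leq_ltn_trans lt_ii' _.
    have Pi1 : P i.+1 by apply: (Pconv i _ i') => //; rewrite leqnSn.
    apply: connect_trans (IHn (Ordinal i1N) Pi1 _); last by rewrite /=; lia.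
    by apply: connect1; apply: BE => //; apply: glink_h.
  have i1N : i.-1 < N.+1 by apply: leq_ltn_trans (ltn_ord i); apply: leq_pred.
  have Pi1 : P i.-1.
    by apply: (Pconv i' _ i) => //; rewrite leq_pred andbT; lia.
  apply: connect_trans (IHn (Ordinal i1N) Pi1 _); last by rewrite /=; lia.
  by apply: connect1; apply: BE => //; rewrite glinkC; apply: glink_h => /=; lia.
have [n] := ubnP (j - j' + (j' - j)); elim: n j Qj => // n IHn j Qj.
rewrite ltnS => len; case: (ltngtP j j') => [lt_jj'|gt_jj'|/val_inj->] //.
  have j1N : j.+1 < N.+1 by apply: leq_ltn_trans lt_jj' _.
  have Qj1 : Q j.+1 by apply: (Qconv j _ j') => //; rewrite leqnSn.
  apply: connect_trans (IHn (Ordinal j1N) Qj1 _); last by rewrite /=; lia.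
  by apply: connect1; apply: BE => //; apply: glink_v.
have j1N : j.-1 < N.+1 by apply: leq_ltn_trans (ltn_ord j); apply: leq_pred.
have Qj1 : Q j.-1.
  by apply: (Qconv j' _ j) => //; rewrite leq_pred andbT; lia.
apply: connect_trans (IHn (Ordinal j1N) Qj1 _); last by rewrite /=; lia.
by apply: connect1; apply: BE => //; rewrite glinkC; apply: glink_v => /=; lia.
Qed.

Lemma glink_connected u w : connect glink u w.
Proof. by apply: (@box_connected xpredT xpredT) => //. Qed.

End Grid.

Theorem grid_minor_faces (W : finType) (adj : rel W) N (p : gvertex N -> option W) :
  symmetric adj -> irreflexive adj -> 0 < #|W| ->
  (forall x, exists u, p u = Some x) ->
  parts_connected (@glink N) p ->
  (forall x y, adj x y -> exists u w, [/\ glink u w, p u = Some x & p w = Some y]) ->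
  exists (P : finType) (bd : P -> rel W), face_family adj bd.
Proof.
move=> adjC adjxx /card_gt0P[x0 _] p_surj pconn padj.
have [|own [ownE ownC]] := grow_parts (@glinkC N) (@glink_connected N) pconn.
  by have [u pu] := p_surj x0; exists u; rewrite pu.
apply: (minor_faces adjC adjxx (@grid_facial N) _ ownC).
  by move=> x; have [u /ownE] := p_surj x; exists u.
by move=> x y /padj[u [w [uw /ownE pu /ownE pw]]]; exists u, w.
Qed.

(** * From walks on the grid to a minor of the grid *)

(** A vertex x is drawn as a set [blob x] of grid points, and an edge with the
    orientation o as a walk between two blobs; outside the blobs of their ends,
    different walks share no point. *)
Section DiscreteDrawing.

Variables (N : nat) (W : finType) (adj o : rel W).
Hypothesis o_total : forall x y, adj x y -> o x y || o y x.
Hypothesis o_irr : irreflexive o.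
Variables (blob : W -> pred (gvertex N)) (len : W -> W -> nat)
  (walk : W -> W -> nat -> gvertex N).
Hypothesis blob_ex : forall x, exists u, blob x u.
Hypothesis blob_conn : forall x u w, blob x u -> blob x w ->
  connect [rel a b | [&& glink a b, blob x a & blob x b]] u w.
Hypothesis blob_disj : forall x y u, blob x u -> blob y u -> x = y.
Hypothesis walk_start : forall x y, o x y -> blob x (walk x y 0).
Hypothesis walk_end : forall x y, o x y -> blob y (walk x y (len x y)).
Hypothesis walk_step : forall x y k, o x y -> k < len x y ->
  walk x y k = walk x y k.+1 \/ glink (walk x y k) (walk x y k.+1).
Hypothesis walk_blob : forall x y z k, o x y -> k <= len x y ->
  blob z (walk x y k) -> z = x \/ z = y.
Hypothesis walk_disj : forall x y x' y' k k', o x y -> o x' y' ->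
  k <= len x y -> k' <= len x' y' -> walk x y k = walk x' y' k' ->
  ~~ blob x (walk x y k) -> ~~ blob y (walk x y k) ->
  ~~ blob x' (walk x y k) -> ~~ blob y' (walk x y k) -> (x, y) = (x', y').

(** The last point of the walk in the first blob before the walk reaches the second
    blob for the first time: between them the walk is outside both. *)
Lemma walk_segment (e : W * W) : exists ij : nat * nat, o e.1 e.2 ->
  [/\ ij.1 < ij.2 <= len e.1 e.2, blob e.1 (walk e.1 e.2 ij.1),
      blob e.2 (walk e.1 e.2 ij.2)
    & forall k, ij.1 < k < ij.2 ->
        ~~ blob e.1 (walk e.1 e.2 k) && ~~ blob e.2 (walk e.1 e.2 k)].
Proof.
case: e => x y /=; have [oxy|] := boolP (o x y); last by exists (0, 0).
have exj : exists j, blob y (walk x y j) by exists (len x y); apply: walk_end.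
have [j yj minj] := ex_minnP exj.
have exi : exists i, (i < j) && blob x (walk x y i).
  exists 0; rewrite walk_start // andbT lt0n; apply/eqP => j0.
  suff e : y = x by move: oxy; rewrite e o_irr.
  apply: blob_disj yj _.
  by rewrite j0; apply: walk_start.
have bound i : (i < j) && blob x (walk x y i) -> i <= j by case/andP => /ltnW.
have [i /andP[ij xi] maxi] := ex_maxnP exi bound.
exists (i, j) => _ /=; split=> //; first by rewrite ij minj ?walk_end.
move=> k /andP[ik kj]; apply/andP; split; apply/negP => bk.
  by have := maxi k; rewrite kj bk leqNgt ik => /(_ isT).
by have := minj k bk; rewrite leqNgt kj.
Qed.

(** The part of x is its blob together with the inner points of the segments of
    the walks that start at x. *)
Theorem discrete_drawing_parts : exists p : gvertex N -> option W,
  [/\ forall x, exists u, p u = Some x,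
      parts_connected (@glink N) p &
      forall x y, adj x y -> exists u w, [/\ glink u w, p u = Some x & p w = Some y]].
Proof.
have [seg segP] := fin_all_exists walk_segment.
pose inner e u := has (fun k => walk e.1 e.2 k == u)
  (iota (seg e).1.+1 ((seg e).2 - (seg e).1.+1)).
pose p u := if [pick x | blob x u] is Some x then Some x else
  if [pick e | o e.1 e.2 && inner e u] is Some e then Some e.1 else None.
have innerP e u : inner e u -> exists2 k, (seg e).1 < k < (seg e).2 & u = walk e.1 e.2 k.
  case/hasP => k; rewrite mem_iota => /andP[ik kj] /eqP <-; exists k => //.
  by rewrite ik; lia.
have p_blob x u : blob x u -> p u = Some x.
  rewrite /p; case: pickP => [y yu xu|/(_ x) ->] //.
  by rewrite (blob_disj xu yu).
have no_blob e k : o e.1 e.2 -> (seg e).1 < k < (seg e).2 ->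
    forall z, ~~ blob z (walk e.1 e.2 k).
  move=> oe ikj z; have [/andP[_ jl] _ _ /(_ k ikj) /andP[n1 n2]] := segP e oe.
  have kl : k <= len e.1 e.2 by case/andP: ikj => _ /ltnW /leq_trans ->.
  apply/negP => bz; have [e1|e1] := walk_blob oe kl bz; rewrite e1 in bz.
    by rewrite bz in n1.
  by rewrite bz in n2.
have p_inner e k : o e.1 e.2 -> (seg e).1 < k < (seg e).2 ->
    p (walk e.1 e.2 k) = Some e.1.
  move=> oe ikj; have nb := no_blob e k oe ikj; rewrite /p.
  case: pickP => [z bz|_]; first by have := nb z; rewrite bz.
  have [/andP[_ jl] _ _ _] := segP e oe.
  case: pickP => [e' /andP[oe' /innerP[k' ikj' ek]]|/(_ e)].
    have [/andP[_ jl'] _ _ _] := segP e' oe'.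
    have [/andP[_ /ltnW kj] /andP[_ /ltnW kj']] := conj ikj ikj'.
    by have [->] := walk_disj oe oe' (leq_trans kj jl) (leq_trans kj' jl') ek
      (nb _) (nb _) (nb _) (nb _).
  rewrite oe => /negP[]; apply/hasP; exists k => //.
  by rewrite mem_iota; move: ikj; lia.
have to_blob x u : p u = Some x ->
    exists2 v, blob x v & connect (in_part (@glink N) p x) u v.
  rewrite /p; case: pickP => [y yu [<-]|_]; first by exists u.
  case: pickP => // -[x' y] /andP[oe /innerP[k ikj ->]] [<-] {u x}.
  rewrite /= in oe ikj *; have [/andP[ij jl] xi _ _] := segP (x', y) oe.
  move: ij jl xi ikj; set i := (seg _).1; set j := (seg _).2 => ij jl xi /=.
  elim: k => // k IHk /andP[ik kj].
  have pk1 : p (walk x' y k.+1) = Some x' by apply: (p_inner (x', y)); rewrite ?ik.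
  have klen : k < len x' y by apply: leq_trans (ltnW kj) jl.
  have [v xv kv] : exists2 v, blob x' v &
      connect (in_part (@glink N) p x') (walk x' y k) v.
    have [eik|nik] := eqVneq i k; first by exists (walk x' y k); rewrite -?eik.
    by apply: IHk; rewrite (ltnW kj) andbT ltn_neqAle nik -ltnS.
  exists v => //; have [<- //|lk] := walk_step oe klen.
  apply: connect_trans kv; apply: connect1.
  have pk : p (walk x' y k) = Some x'.
    have [<-|nik] := eqVneq i k; first exact: p_blob.
    by apply: (p_inner (x', y)); rewrite //= (ltnW kj) andbT ltn_neqAle nik -ltnS.
  by rewrite /in_part /= glinkC lk pk pk1 eqxx.
have symp x : connect_sym (in_part (@glink N) p x).
  by apply: sym_connect_sym => a b; rewrite /in_part /= glinkC [X in _ && X]andbC.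
have blob_in x u v : blob x u -> blob x v -> connect (in_part (@glink N) p x) u v.
  move=> bu bv; apply: connect_sub (blob_conn bu bv) => a b /and3P[ab xa xb].
  by apply: connect1; rewrite /in_part /= ab (p_blob x) // (p_blob x) // eqxx.
exists p; split=> [x|x u w pu pw|x y xy].
- by have [u xu] := blob_ex x; exists u; apply: p_blob.
- have [v xv uv] := to_blob x u pu; have [v' xv' wv'] := to_blob x w pw.
  apply: connect_trans uv _; apply: connect_trans (blob_in x v v' xv xv') _.
  by rewrite symp.
have oriented x' y' : o x' y' ->
    exists u w, [/\ glink u w, p u = Some x' & p w = Some y'].
  move=> oe; have [/= /andP[ij jl] xi yj _] := segP (x', y') oe.
  move: ij jl xi yj (p_inner (x', y')); set i := (seg _).1; set j := (seg _).2.
  case: j => // j ij jl xi yj inn; exists (walk x' y' j), (walk x' y' j.+1).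
  have pj : p (walk x' y' j) = Some x'.
    have [<-|nij] := eqVneq i j; first exact: p_blob.
    by apply: inn; rewrite //= ltnSn andbT ltn_neqAle nij -ltnS.
  have pj1 := p_blob _ _ yj; split=> //.
  have [e|//] := walk_step oe jl; move: pj; rewrite e pj1 => -[exy].
  by rewrite exy o_irr in oe.
case/orP: (o_total xy) => /oriented // [u [w [uw pu pw]]].
by exists w, u; rewrite glinkC.
Qed.

End DiscreteDrawing.

(** * Compactness arguments in the plane *)

Section PlaneTopology.
Import classical_sets.
Local Open Scope classical_set_scope.
Local Open Scope ring_scope.
Variable R : realType.
Implicit Types (g : R -> R * R) (K L : set (R * R)).

Definition clamp (t : R) : R := Num.max 0 (Num.min t 1).

Lemma clamp01 t : 0 <= clamp t <= 1.
Proof. by rewrite /clamp /Order.max /Order.min; do 2!case: ifPn; lra. Qed.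

Lemma clamp_id t : 0 <= t <= 1 -> clamp t = t.
Proof. by rewrite /clamp /Order.max /Order.min; do 2!case: ifPn; lra. Qed.

Lemma clamp_dist s t : `|clamp s - clamp t| <= `|s - t|.
Proof.
rewrite ler_norml; apply/andP.
have := ler_norm (s - t); have := ler_norm (- (s - t)); rewrite normrN.
rewrite /clamp /Order.max /Order.min; do 4!case: ifPn; lra.
Qed.

(** An arc, continuous on the unit interval only, is extended to the whole line so
    that continuity need not be relativized afterwards. *)
Lemma clamp_continuous g : {within `[0, 1], continuous g} -> continuous (g \o clamp).
Proof.
move=> /subspace_continuousP gc t; apply/cvgrPdist_lt => e e0.
have c01 : `[0, 1]%classic (clamp t) by rewrite /= in_itv /= clamp01.
have /cvgrPdist_lt /(_ e e0) := gc _ c01.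
rewrite near_withinE => /nbhs_ballP[d /= d0 gd].
apply/nbhs_ballP; exists d => //= s ts.
apply: gd => /=; last by rewrite in_itv /= clamp01.
exact: le_lt_trans (clamp_dist _ _) ts.
Qed.

Lemma positive_dist (T : topologicalType) (K : set T) (f : T -> R) :
  compact K -> continuous f -> (forall x, K x -> 0 < f x) ->
  exists2 d : R, 0 < d & forall x, K x -> d <= f x.
Proof.
move=> cK cf f_gt0; have [->|/set0P K0] := eqVneq K set0.
  by exists 1.
have [x0 x0K x0min] := compact_EVT_min K0 cK (continuous_subspaceT cf).
exists (f x0); first by apply: f_gt0; rewrite inE in x0K.
by move=> x Kx; apply: x0min; rewrite inE.
Qed.

Lemma dist_continuous (T : topologicalType) (V : normedModType R) (f g : T -> V) :
  continuous f -> continuous g -> continuous (fun x => `|f x - g x|).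
Proof. by move=> cf cg x; apply: cvg_norm; apply: cvgB; [apply: cf|apply: cg]. Qed.

Lemma compact_separated K L : compact K -> compact L -> K `&` L = set0 ->
  exists2 d : R, 0 < d & forall p q, K p -> L q -> d <= `|p - q|.
Proof.
move=> cK cL disj.
have [|||d d0 dP] := @positive_dist _ (K `*` L) (fun pq => `|pq.1 - pq.2|).
- exact: compact_setX.
- by apply: dist_continuous => x; [apply: cvg_fst|apply: cvg_snd].
- move=> [p q] [/= Kp Lq]; rewrite normr_gt0 subr_eq0; apply/eqP => pq.
  have : (K `&` L) p by split=> //; rewrite pq.
  by rewrite disj.
by exists d => // p q Kp Lq; apply: (dP (p, q)).
Qed.

(** On the compact set of pairs (s, t) with |g s - g t| >= e, the distance |s - t|
    does not vanish, so it has a positive lower bound. *)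
Lemma uniformly_continuous01 g e : continuous g -> 0 < e -> exists2 d : R, 0 < d &
  forall s t, 0 <= s <= 1 -> 0 <= t <= 1 -> `|s - t| < d -> `|g s - g t| < e.
Proof.
move=> cg e0.
pose D := (`[0, 1]%classic `*` `[0, 1]%classic) `&` ((fun st : R * R => `|g st.1 - g st.2|) @^-1` [set x | e <= x]).
have cont1 : continuous (fun st : R * R => `|g st.1 - g st.2|).
  apply: dist_continuous => x; apply: continuous_comp.
  - exact: cvg_fst.
  - exact: cg.
  - exact: cvg_snd.
  - exact: cg.
have [|||d d0 dP] := @positive_dist _ D (fun st => `|st.1 - st.2|).
- apply: compact_closedI; first by apply: compact_setX; apply: segment_compact.
  apply: preimage_closed; last exact: closed_ge.
  by move=> x _; apply: cont1.
- by apply: dist_continuous => x; [apply: cvg_fst|apply: cvg_snd].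
- move=> [s t] [_ /= est]; rewrite normr_gt0 subr_eq0; apply/eqP => st.
  by move: est; rewrite st subrr normr0 leNgt e0.
exists d => // s t s01 t01; rewrite !ltNge; apply: contra => est.
by apply: (dP (s, t)); split=> //; split; rewrite /= in_itv.
Qed.

Lemma curve_compact g : continuous g -> compact (g @` `[0, 1]).
Proof.
move=> cg; apply: continuous_compact; last exact: segment_compact.
exact: continuous_subspaceT.
Qed.

Lemma curve_bounded g : continuous g -> exists B, forall t, 0 <= t <= 1 -> `|g t| <= B.
Proof.
move=> /curve_compact /compact_bounded [B [_ BP]].
exists (B + 1) => t t01; apply: (BP (B + 1)); first by rewrite ltrDl.
by exists t => //=; rewrite in_itv.
Qed.

Lemma far_closed (p : R * R) r : closed [set q | r <= `|q - p|].
Proof.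
apply: (@preimage_closed _ _ (fun q : R * R => `|q - p|) [set x | r <= x]).
  by move=> q _; apply: dist_continuous => x; [apply: cvg_id|apply: cvg_cst].
exact: closed_ge.
Qed.

Lemma finite_min (I : finType) (P : I -> R -> Prop) :
  (forall i d d', P i d -> d' <= d -> P i d') ->
  (forall i, exists2 d, 0 < d & P i d) -> exists2 d, 0 < d & forall i, P i d.
Proof.
move=> mono ex.
have [d dP] : exists d : I -> R, forall i, 0 < d i /\ P i (d i).
  apply: (@fin_all_exists _ (fun=> R) (fun i d => 0 < d /\ P i d)) => i.
  by have [d d0 Pd] := ex i; exists d.
exists (\big[Num.min/1]_i d i).
  by apply/bigmin_gtP; split=> // i _; have [] := dP i.
by move=> i; have [_ Pi] := dP i; apply: mono Pi _; apply: bigmin_le.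
Qed.

End PlaneTopology.

(** * Sampling curves on a grid of mesh h *)

Section GridModel.
Local Open Scope ring_scope.
Variable R : realType.

Lemma plane_dist_le (p q : R * R) e :
  (`|p - q| <= e) = (`|p.1 - q.1| <= e) && (`|p.2 - q.2| <= e).
Proof. by rewrite prod_normE ge_max. Qed.

Lemma plane_dist_lt (p q : R * R) e :
  (`|p - q| < e) = (`|p.1 - q.1| < e) && (`|p.2 - q.2| < e).
Proof. by rewrite prod_normE gt_max. Qed.

Lemma finite_max (I : finType) (P : I -> R -> Prop) :
  (forall i d d', P i d -> d <= d' -> P i d') ->
  (forall i, exists d, P i d) -> exists d, forall i, P i d.
Proof.
move=> mono ex.
have [d dP] := @fin_all_exists _ (fun=> R) P ex.
exists (\big[Num.max/0]_i d i) => i.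
by apply: mono (dP i) _; apply: le_bigmax.
Qed.

Variables (B h : R).
Hypothesis h0 : 0 < h.

Definition coord (x : R) : nat := Num.trunc ((x + B) / h).

Definition grid_size : nat := Num.trunc ((B + B) / h).
Local Notation N := grid_size.

(** The grid covers the square of the points whose coordinates have absolute value
    at most B; [vert] rounds down to a grid point and [point] is the position of a
    grid point in the plane. *)
Definition vert (p : R * R) : gvertex N := (inord (coord p.1), inord (coord p.2)).

Definition point (u : gvertex N) : R * R := (u.1%:R * h - B, u.2%:R * h - B).

Lemma coord_lt x : `|x| <= B -> (coord x < N.+1)%N.
Proof.
rewrite ler_norml ltnS => /andP[_ xB]; apply: le_truncn.
by rewrite ler_pM2r ?invr_gt0 // lerD2r.
Qed.

Lemma coord_close x : `|x| <= B -> `|(coord x)%:R * h - B - x| <= h.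
Proof.
rewrite ler_norml => /andP[Bx xB].
have /truncn_itv/andP[lo hi] : 0 <= (x + B) / h.
  by apply: divr_ge0; [lra|exact: ltW].
move: lo hi; rewrite -/(coord x) ler_pdivlMr // ltr_pdivrMr // -natr1 mulrDl mul1r.
by rewrite ler_norml => lo hi; apply/andP; split; lra.
Qed.

Lemma coord_step x y : `|x| <= B -> `|y| <= B -> `|x - y| < h ->
  (coord x <= (coord y).+1)%N.
Proof.
rewrite !ler_norml ltr_norml => /andP[Bx xB] /andP[By yB] /andP[_ xy].
have /truncn_itv/andP[_ hi] : 0 <= (y + B) / h.
  by apply: divr_ge0; [lra|exact: ltW].
rewrite -ltnS truncn_lt_nat; last by apply: divr_ge0; [lra|exact: ltW].
move: hi; rewrite -/(coord y) !ltr_pdivrMr // -natr1 => hi.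
by rewrite -natr1 mulrDl mul1r; lra.
Qed.

Lemma plane_bound (p : R * R) : `|p| <= B -> `|p.1| <= B /\ `|p.2| <= B.
Proof. by rewrite prod_normE ge_max => /andP. Qed.

Lemma vert_close p : `|p| <= B -> `|point (vert p) - p| <= h.
Proof.
case/plane_bound => p1 p2; rewrite plane_dist_le /= !inordK ?coord_lt //.
by rewrite !coord_close.
Qed.

Lemma grid_step_h (i i' j : 'I_N.+1) : (i <= i'.+1)%N -> (i' <= i.+1)%N ->
  (i, j) = (i', j) \/ glink (i, j) (i', j).
Proof.
move=> ii' i'i; case: (ltngtP i i') => [lt|gt|/val_inj->]; [right|right|by left].
  by apply: glink_h; apply/eqP; rewrite eqn_leq i'i.
by rewrite glinkC; apply: glink_h; apply/eqP; rewrite eqn_leq ii'.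
Qed.

Lemma grid_step_v (i j j' : 'I_N.+1) : (j <= j'.+1)%N -> (j' <= j.+1)%N ->
  (i, j) = (i, j') \/ glink (i, j) (i, j').
Proof.
move=> jj' j'j; case: (ltngtP j j') => [lt|gt|/val_inj->]; [right|right|by left].
  by apply: glink_v; apply/eqP; rewrite eqn_leq j'j.
by rewrite glinkC; apply: glink_v; apply/eqP; rewrite eqn_leq jj'.
Qed.

Definition square (c : R * R) (rad : R) : pred (gvertex N) :=
  fun u => `|point u - c| <= rad.

Lemma square_connected c rad u w : square c rad u -> square c rad w ->
  connect [rel a b | [&& glink a b, square c rad a & square c rad b]] u w.
Proof.
pose P x0 (i : nat) := `|i%:R * h - B - x0| <= rad.
have squareE a : square c rad a = P c.1 a.1 && P c.2 a.2.
  by rewrite /square plane_dist_le.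
have conv x0 i j k : P x0 i -> P x0 k -> (i <= j <= k)%N -> P x0 j.
  rewrite /P !ler_norml => /andP[i1 i2] /andP[k1 k2] /andP[ij jk].
  have ijR : i%:R * h <= j%:R * h by rewrite ler_pM2r // ler_nat.
  have jkR : j%:R * h <= k%:R * h by rewrite ler_pM2r // ler_nat.
  by apply/andP; split; lra.
rewrite !squareE => /andP[u1 u2] /andP[w1 w2].
apply: (@box_connected N (P c.1) (P c.2)) => //.
- exact: conv.
- exact: conv.
by move=> a b ab a1 a2 b1 b2; rewrite /= ab !squareE a1 a2 b1 b2.
Qed.

(** Consecutive samples of a curve, at the multiples of 1/M, may round to points
    that differ in both coordinates; the walk then updates the first coordinate
    at odd steps and the second one at even steps. *)
Definition sample_walk (g : R -> R * R) (M k : nat) : gvertex N :=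
  let a := vert (g (k./2%:R / M%:R)) in
  let b := vert (g (k./2.+1%:R / M%:R)) in
  if odd k then (b.1, a.2) else a.

Section SampleWalk.
Variables (g : R -> R * R) (M : nat).
Hypothesis gB : forall t, 0 <= t <= 1 -> `|g t| <= B.
Hypothesis M_gt0 : (0 < M)%N.
Hypothesis gM : forall i, (i < M)%N -> `|g (i%:R / M%:R) - g (i.+1%:R / M%:R)| < h.

Lemma sample01 i : (i <= M)%N -> 0 <= (i%:R / M%:R : R) <= 1.
Proof.
move=> iM; rewrite divr_ge0 //=.
by rewrite ler_pdivrMr ?ltr0n // mul1r ler_nat.
Qed.

Lemma sample_walk_close k : (k <= M.*2)%N ->
  `|point (sample_walk g M k) - g (k./2%:R / M%:R)| <= 2 * h.
Proof.
move=> kM; have k2 : (k./2 <= M)%N by rewrite -(doubleK M) half_leq.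
have ca := vert_close (gB (sample01 k2)).
rewrite /sample_walk; case: ifP => [ok|_]; last by apply: le_trans ca _; move: h0; lra.
have k2M : (k./2 < M)%N.
  by move: kM (odd_double_half k); rewrite ok; clear; lia.
have cb := vert_close (gB (sample01 k2M)).
move: ca cb (gM k2M); rewrite !plane_dist_le plane_dist_lt /=.
move=> /andP[_ a2] /andP[b1 _] /andP[ab1 _]; apply/andP; split; last first.
  by apply: le_trans a2 _; move: h0; lra.
move: b1 ab1; set v := _ * h - B; rewrite !ler_norml ltr_norml => /andP[? ?] /andP[? ?].
by apply/andP; split; lra.
Qed.

Lemma sample_walk_step k : (k < M.*2)%N ->
  sample_walk g M k = sample_walk g M k.+1 \/
  glink (sample_walk g M k) (sample_walk g M k.+1).
Proof.
move=> kM; have k2M : (k./2 < M)%N by move: kM (odd_double_half k); case: (odd k); lia.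
have a := plane_bound (gB (sample01 (ltnW k2M))).
have b := plane_bound (gB (sample01 k2M)).
have := gM k2M; rewrite plane_dist_lt => /andP[ab1 ab2].
have ba1 := ab1; have ba2 := ab2; rewrite distrC in ba1; rewrite distrC in ba2.
rewrite /sample_walk /= uphalf_half; case: (odd k) => /=; rewrite ?add0n ?add1n.
  by apply: grid_step_v; rewrite /= !inordK ?coord_lt ?(proj1 a, proj2 a, proj1 b, proj2 b) //;
    apply: coord_step; rewrite ?(proj1 a, proj2 a, proj1 b, proj2 b) //.
rewrite [vert (g (k./2%:R / _))]surjective_pairing.
by apply: grid_step_h; rewrite /= !inordK ?coord_lt ?(proj1 a, proj2 a, proj1 b, proj2 b) //;
  apply: coord_step; rewrite ?(proj1 a, proj2 a, proj1 b, proj2 b) //.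
Qed.

End SampleWalk.
End GridModel.

(** * A planar graph is a minor of a grid *)

Section PlanarGrid.
Local Open Scope ring_scope.
Variables (R : realType) (G : sgraph).

(** Three scales are chosen in turn.  The radius r keeps each vertex away from the
    others and from the arcs that do not end there.  The distance delta separates
    the parts of different arcs that are further than r from their ends, which are
    disjoint compact sets.  The mesh h is small compared to both.  The blob of x is
    the square of radius 2r around x, and the walks follow the arcs at distance at
    most 2h. *)
Theorem planar_grid_parts : planar R G ->
  exists N (p : gvertex N -> option G),
  [/\ forall x, exists u, p u = Some x,
      parts_connected (@glink N) p &
      forall x y, adj x y -> exists u w, [/\ glink u w, p u = Some x & p w = Some y]].
Proof.
move=> [pos [arc [pos_inj arcP arc_rev arc_avoid arc_cross]]].
pose g (e : G * G) := arc e.1 e.2 \o @clamp R.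
have in01 t : 0 <= t <= 1 -> t \in `[(0:R), 1] by rewrite in_itv.
have gE e t : 0 <= t <= 1 -> g e t = arc e.1 e.2 t by move=> t01; rewrite /g /= clamp_id.
have t0 : 0 <= (0:R) <= 1 by rewrite lexx ler01.
have t1 : 0 <= (1:R) <= 1 by rewrite lexx ler01.
have g_cont (e : G * G) : adj e.1 e.2 -> continuous (g e).
  by move=> /arcP[c _ _ _]; apply: clamp_continuous.
have g_start (e : G * G) : adj e.1 e.2 -> g e 0 = pos e.1.
  by move=> /arcP[_ _ <- _]; rewrite gE.
have g_end (e : G * G) : adj e.1 e.2 -> g e 1 = pos e.2.
  by move=> /arcP[_ _ _ <-]; rewrite gE.
have g_inner (e : G * G) t : adj e.1 e.2 -> 0 <= t <= 1 ->
    g e t != pos e.1 -> g e t != pos e.2 -> t \in `](0:R), 1[.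
  move=> ea /andP[]; rewrite in_itv /= !le_eqVlt => /orP[/eqP<-|->].
    by rewrite g_start // eqxx.
  by move=> /orP[/eqP->|-> //]; rewrite g_end // eqxx.
(* The scale r: blobs of radius 2r, with all margins, fit into distance 8r. *)
have [r r0 rP] : exists2 r : R, 0 < r & forall xyz : G * G * G,
    let: (x, y, z) := xyz in
    (x != z -> 8 * r <= `|pos x - pos z|) /\
    (adj x y -> z != x -> z != y ->
       forall t, 0 <= t <= 1 -> 8 * r <= `|g (x, y) t - pos z|).
  apply: finite_min => [[[x y] z] d d' [d1 d2] dd'|[[x y] z]].
    split=> [/d1|xy zx zy t /(d2 xy zx zy)] h; apply: le_trans h; lra.
  have [d1 d10 d1P] : exists2 d : R, 0 < d & (x != z -> d <= `|pos x - pos z|).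
    have [->|xz] := eqVneq x z; first by exists 1.
    exists `|pos x - pos z| => //.
    by rewrite normr_gt0 subr_eq0 (inj_eq pos_inj).
  have [d2 d20 d2P] : exists2 d : R, 0 < d & (adj x y -> z != x -> z != y ->
       forall t, 0 <= t <= 1 -> d <= `|g (x, y) t - pos z|).
    have [xy|nxy] := boolP (adj x y); last by exists 1.
    have [zx|nzx] := eqVneq z x; first by exists 1.
    have [zy|nzy] := eqVneq z y; first by exists 1.
    have [] := @positive_dist R _ _ (fun t => `|g (x, y) t - pos z|)
        (@segment_compact R 0 1).
    - apply: dist_continuous; first exact: (g_cont (x, y)).
      by move=> t; apply: cvg_cst.
    - move=> t /=; rewrite in_itv /= => t01; rewrite normr_gt0 subr_eq0.
      apply/eqP => gz; have t_in : t \in `](0:R), 1[.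
        by apply: (g_inner (x, y)); rewrite //= gz (inj_eq pos_inj).
      by apply: (arc_avoid x y z xy t t_in); rewrite -gz gE.
    by move=> d d0 dP; exists d => // _ _ _ t t01; apply: dP; rewrite /= in_itv.
  exists (Num.min d1 d2 / 8); first by rewrite divr_gt0 // lt_min d10.
  have [m1 m2] : Num.min d1 d2 <= d1 /\ Num.min d1 d2 <= d2 by rewrite !ge_min !lexx orbT.
  split=> [/d1P|xy zx zy t /(d2P xy zx zy)]; lra.
have r_vert x z : x != z -> 8 * r <= `|pos x - pos z|.
  by move=> xz; have [] := rP (x, x, z) => /(_ xz).
have r_arc x y z t : adj x y -> z != x -> z != y -> 0 <= t <= 1 ->
    8 * r <= `|g (x, y) t - pos z|.
  by move=> xy zx zy t01; have [_] := rP (x, y, z) => /(_ xy zx zy t t01).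
pose far e t := (r <= `|g e t - pos e.1|) && (r <= `|g e t - pos e.2|).
have [delta delta0 deltaP] : exists2 delta : R, 0 < delta &
    forall ef : (G * G) * (G * G), let: (e, f) := ef in
    adj e.1 e.2 -> adj f.1 f.2 -> [set e.1; e.2]%SET != [set f.1; f.2]%SET ->
    forall s t, 0 <= s <= 1 -> 0 <= t <= 1 -> far e s -> far f t ->
      delta <= `|g e s - g f t|.
  apply: finite_min => [[e f] d d' dP dd' ea fa ef s t s01 t01 es ft|[e f]].
    exact: le_trans dd' (dP ea fa ef s t s01 t01 es ft).
  have [ea|na] := boolP (adj e.1 e.2); last by exists 1.
  have [fa|na] := boolP (adj f.1 f.2); last by exists 1.
  have [ef|nef] := eqVneq [set e.1; e.2]%SET [set f.1; f.2]%SET; first by exists 1.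
  pose K e := (((g e @` `[0, 1]) `&` [set q | r <= `|q - pos e.1|])
                  `&` [set q | r <= `|q - pos e.2|])%classic.
  have cK e' : adj e'.1 e'.2 -> compact (K e').
    move=> ea'; apply: compact_closedI; last exact: far_closed.
    apply: compact_closedI; last exact: far_closed.
    by apply: curve_compact; apply: g_cont.
  have inK e' t : 0 <= t <= 1 -> far e' t -> K e' (g e' t).
    by move=> t01 /andP[h1 h2]; split=> //; split=> //; exists t => //=; rewrite in_itv.
  have K_inner e' q : adj e'.1 e'.2 -> K e' q ->
      exists2 t, t \in `](0:R), 1[ & q = arc e'.1 e'.2 t.
    move=> ea' [[[t /=]]]; rewrite in_itv /= => t01 <- h1 h2.
    have t_in : t \in `](0:R), 1[.
      have neq z : r <= `|g e' t - z| -> g e' t != z.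
        by apply: contraTneq => ->; rewrite subrr normr0 -ltNge.
      by apply: (g_inner e') => //; apply: neq.
    by exists t => //; rewrite gE.
  have disj : (K e `&` K f)%classic = classical_sets.set0.
    rewrite -classical_sets.subset0 => q [/(K_inner e q ea)[s s_in ->] /(K_inner f _ fa)[t t_in]].
    exact: arc_cross.
  have [d d0 dP] := compact_separated (cK e ea) (cK f fa) disj.
  by exists d => // _ _ _ s t s01 t01 es ft; apply: dP; apply: inK.
(* The mesh: 8h <= r and 8h <= delta absorb the errors 2h of the walks. *)
pose h := Num.min r delta / 8.
have h0 : 0 < h by rewrite divr_gt0 // lt_min r0.
have [hr hdelta] : 8 * h <= r /\ 8 * h <= delta.
  rewrite /h mulrCA divff ?mulr1; last by rewrite pnatr_eq0.
  by rewrite !ge_min !lexx orbT.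
have [M MP] : exists M : G * G -> nat, forall e, (0 < M e)%N /\ (adj e.1 e.2 ->
    forall i, (i < M e)%N -> `|g e (i%:R / (M e)%:R) - g e (i.+1%:R / (M e)%:R)| < h).
  apply: (@fin_all_exists _ (fun=> nat) (fun e M => (0 < M)%N /\ (adj e.1 e.2 ->
    forall i, (i < M)%N -> `|g e (i%:R / M%:R) - g e (i.+1%:R / M%:R)| < h))) => e.
  have [ea|na] := boolP (adj e.1 e.2); last by exists 1%N.
  have [d d0 dP] := uniformly_continuous01 (g_cont e ea) h0.
  pose M := (Num.trunc (d^-1)).+1; have M0 : 0 < M%:R :> R by rewrite ltr0n.
  exists M; split=> // _ i iM; apply: dP.
  - by apply: sample01 => //; apply: ltnW.
  - exact: sample01.
  rewrite -mulrBl -natr1 opprD addNKr normrM normrN1 mul1r gtr0_norm ?invr_gt0 //.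
  by rewrite invf_plt ?posrE // truncnS_gt.
have [B BP] : exists B, forall ez : (G * G) * G, `|pos ez.2| <= B /\
    (adj ez.1.1 ez.1.2 -> forall t, 0 <= t <= 1 -> `|g ez.1 t| <= B).
  apply: finite_max => [[e z] d d' [d1 d2] dd'|[e z]] /=.
    by split=> [|ea t t01]; apply: le_trans dd'; [|apply: d2].
  have [ea|na] := boolP (adj e.1 e.2); last by exists `|pos z|.
  have [b bP] := curve_bounded (g_cont e ea); exists (Num.max b `|pos z|).
  by split=> [|_ t /bP]; rewrite le_max ?lexx ?orbT // => ->.
have posB z : `|pos z| <= B by have [] := BP ((z, z), z).
have gB e : adj e.1 e.2 -> forall t, 0 <= t <= 1 -> `|g e t| <= B.
  by move=> ea; have [_] := BP (e, e.1) => /(_ ea).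
have gM e (ea : adj e.1 e.2) := (MP e).2 ea.
pose blob (x : G) := @square R B h (pos x) (2 * r).
pose walk (x y : G) := sample_walk B h (g (x, y)) (M (x, y)).
pose len (x y : G) := (M (x, y)).*2.
pose o (x y : G) := adj x y && (enum_rank x < enum_rank y)%N.
have walk_close x y k : adj x y -> (k <= len x y)%N ->
    exists2 t, 0 <= t <= 1 & `|point (walk x y k) - g (x, y) t| <= 2 * h.
  move=> xy kl; exists (k./2%:R / (M (x, y))%:R).
    apply: sample01; first by have [] := MP (x, y).
    by rewrite -(doubleK (M (x, y))) half_leq.
  apply: sample_walk_close => //; last exact: (gM (x, y)).
  - exact: (gB (x, y)).
  - by have [] := MP (x, y).
exists (grid_size B h).
apply: (@discrete_drawing_parts _ G (@adj G) o _ _ blob len walk).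
- move=> x y xy; rewrite /o xy (adj_sym y) xy /= -neq_ltn.
  rewrite (inj_eq val_inj) (inj_eq enum_rank_inj).
  by apply: contraTneq xy => ->; rewrite adj_irrefl.
- by move=> x; rewrite /o ltnn andbF.
- move=> x; exists (vert B h (pos x)); rewrite /blob /square.
  apply: le_trans (vert_close h0 (posB x)) _; move: h0 r0 hr; lra.
- by move=> x u w; apply: square_connected.
- move=> x y u; rewrite /blob /square /= => ux uy; apply/eqP.
  apply: contraT => /r_vert; have := ler_distD (point u) (pos x) (pos y).
  rewrite (distrC (pos x) (point u)); move: ux uy r0; lra.
- move=> x y /andP[xy _]; rewrite /blob /square /walk /sample_walk /= mul0r (g_start (x, y)) //.
  apply: le_trans (vert_close h0 (posB x)) _; move: h0 r0 hr; lra.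
- move=> x y /andP[xy _]; rewrite /blob /square /walk /sample_walk /len odd_double doubleK.
  rewrite divff ?(g_end (x, y)) //; last first.
    by rewrite pnatr_eq0 -lt0n; have [] := MP (x, y).
  apply: le_trans (vert_close h0 (posB y)) _; move: h0 r0 hr; lra.
- move=> x y k /andP[xy _] kl; apply: sample_walk_step => //.
  + exact: (gB (x, y)).
  + by have [] := MP (x, y).
  + exact: (gM (x, y)).
- move=> x y z k /andP[xy _] kl; rewrite /blob /square /= => bz.
  have [t t01 close] := walk_close x y k xy kl.
  have [->|nzx] := eqVneq z x; first by left.
  have [->|nzy] := eqVneq z y; first by right.
  exfalso; have := r_arc x y z t xy nzx nzy t01.
  have := ler_distD (point (walk x y k)) (g (x, y) t) (pos z).
  by rewrite (distrC (g _ _) (point _)); move: bz close hr h0 r0; lra.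
move=> x y x' y' k k' /andP[xy lxy] /andP[xy' lxy'] kl kl' ww.
rewrite /blob /square /= -!ltNge => nx ny nx' ny'.
have [t t01 close] := walk_close x y k xy kl.
have [t' t'01 close'] := walk_close x' y' k' xy' kl'.
rewrite -ww in close'; set u := point _ in nx ny nx' ny' close close'.
have far_t : far (x, y) t.
  by apply/andP; split; [have := ler_distD (g (x, y) t) u (pos x)
    | have := ler_distD (g (x, y) t) u (pos y)]; move: nx ny close hr h0 r0 => /=; lra.
have far_t' : far (x', y') t'.
  by apply/andP; split; [have := ler_distD (g (x', y') t') u (pos x')
    | have := ler_distD (g (x', y') t') u (pos y')]; move: nx' ny' close' hr h0 r0 => /=; lra.
have [e|ne] := eqVneq [set x; y]%SET [set x'; y']%SET.
  have : x' \in [set x; y]%SET by rewrite e set21.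
  have : y' \in [set x; y]%SET by rewrite e set22.
  rewrite !inE => /orP[]/eqP ey /orP[]/eqP ex; rewrite ex ey ?ltnn // in lxy' *.
  by rewrite ltnNge (ltnW lxy) in lxy'.
exfalso; have := deltaP ((x, y), (x', y')) xy xy' ne t t' t01 t'01 far_t far_t'.
have := ler_distD u (g (x, y) t) (g (x', y') t'); rewrite (distrC (g (x, y) t) u).
by move: close close' hdelta h0; lra.
Qed.

End PlanarGrid.

(** * Triangular and quadrilateral faces *)

Section Discharging.

Variables (V F : finType) (adj : rel V) (bd : F -> rel V).
Hypothesis adjC : symmetric adj.
Hypothesis adjxx : irreflexive adj.
Hypothesis bd_adj : forall f x y, bd f x y -> adj x y.
Hypothesis bdC : forall f, symmetric (bd f).
Hypothesis bd_even : forall f x, ~~ odd #|[pred y | bd f x y]|.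
Hypothesis bd_le2 : forall x y, #|[pred f | bd f x y]| <= 2.
Hypothesis bd_indep : forall S : pred F,
  (forall x y, ~~ odd #|[pred f | S f && bd f x y]|) ->
  (exists f, S f) -> forall f, S f.
Hypothesis many_faces : 6 <= #|F|.

Hypothesis noK4 : forall a b c d, adj a b -> adj a c -> adj a d ->
  adj b c -> adj b d -> adj c d -> False.
Hypothesis no_theta : forall u v p q p' q', uniq [:: u; v; p; q; p'; q'] ->
  adj u v -> adj v p -> adj p q -> adj q u ->
  adj v p' -> adj p' q' -> adj q' u -> False.

Local Notation dart := (V * V)%type.

Definition nb_darts (f : F) := #|[pred p : dart | bd f p.1 p.2]|.

Lemma bd_neq f x y : bd f x y -> x != y.
Proof. by move=> /bd_adj; apply: contraTneq => ->; rewrite adjxx. Qed.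

Lemma bd_next f a b : bd f a b -> exists2 c, c != a & bd f b c.
Proof.
move=> fab; apply/exists_inP; apply: contraT => /exists_inPn no_next.
have /eq_card e : [pred y | bd f b y] =i pred1 a; last first.
  by have := bd_even f b; rewrite e card1.
move=> y; rewrite !inE; apply/idP/eqP => [fby|->]; last by rewrite bdC.
by apply/eqP; apply: contraTT fby; apply: no_next.
Qed.

Definition darts_of (s : seq dart) := s ++ [seq (p.2, p.1) | p <- s].

Lemma darts_sub f s : all (fun p => bd f p.1 p.2) s ->
  {subset darts_of s <= [pred p : dart | bd f p.1 p.2]}.
Proof.
move=> /allP fs p; rewrite mem_cat => /orP[/fs //|/mapP[q /fs fq ->]].
by rewrite inE /= bdC.
Qed.

Lemma darts_leq f s : all (fun p => bd f p.1 p.2) s -> uniq (darts_of s) ->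
  2 * size s <= nb_darts f.
Proof.
move=> fs us; rewrite /nb_darts cardE.
have -> : 2 * size s = size (darts_of s) by rewrite size_cat size_map; lia.
by apply: uniq_leq_size => // p /(darts_sub fs); rewrite mem_enum.
Qed.

(** Knowing as many edges as the size of a face allows is knowing the face; the
    shape of short faces is deduced from this. *)
Lemma darts_eq f s : all (fun p => bd f p.1 p.2) s -> uniq (darts_of s) ->
  nb_darts f = 2 * size s -> forall x y, bd f x y = ((x, y) \in darts_of s).
Proof.
move=> fs us; rewrite /nb_darts cardE => sz x y.
have sub : {subset darts_of s <= enum [pred p : dart | bd f p.1 p.2]}.
  by move=> p /(darts_sub fs); rewrite mem_enum.
have szd : size (darts_of s) = 2 * size s by rewrite size_cat size_map; lia.
have [_ e] := uniq_min_size us sub (eq_leq (etrans sz (esym szd))).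
by rewrite e mem_enum inE.
Qed.

Lemma nb_darts_even f : ~~ odd (nb_darts f).
Proof.
rewrite /nb_darts -sum1_card /= (eq_bigl (fun p : dart => predT p.1 && bd f p.1 p.2)) //.
rewrite -(pair_big_dep xpredT (fun x y => bd f x y) (fun _ _ => 1%N)) /=.
elim/big_ind: _ => // [x y /negbTE ox /negbTE oy|x _]; first by rewrite oddD ox oy.
by rewrite sum1_card bd_even.
Qed.

Lemma bd_full x y f g h : bd f x y -> bd g x y -> bd h x y ->
  f != g -> g != h -> f != h -> False.
Proof.
move=> fx gx hx fg gh fh; have := bd_le2 x y; apply/negP; rewrite -ltnNge cardE.
apply: (@uniq_leq_size _ [:: f; g; h]); first by rewrite /= !inE negb_or fg fh gh.
by move=> i; rewrite !inE mem_enum inE => /or3P[]/eqP ->.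
Qed.

(** A list of faces that border each other along all their edges covers each edge
    zero or two times, so it contains all faces. *)
Lemma bd_closed (s : seq F) f0 : f0 \in s ->
  (forall f x y, f \in s -> bd f x y -> exists2 g, g \in s & (g != f) && bd g x y) ->
  #|F| <= size s.
Proof.
move=> f0s clos; rewrite cardE; apply: uniq_leq_size; first exact: enum_uniq.
move=> f _; apply: (bd_indep (S := mem s)); last by exists f0.
move=> x y; set A := [pred _ | _].
have [/eqP|] := boolP (#|A| == 0); first by move->.
rewrite -lt0n => /card_gt0P[f1]; rewrite inE /= => /andP[f1s f1x].
have [g gs /andP[gf1 gx]] := clos _ _ _ f1s f1x.
rewrite (_ : #|A| = 2) //; apply/eqP; rewrite eqn_leq; apply/andP; split.
  apply: leq_trans (bd_le2 x y); apply: subset_leq_card; apply/subsetP => h.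
  by rewrite !inE => /andP[].
rewrite cardE; apply: (@uniq_leq_size _ [:: f1; g]).
  by rewrite /= inE eq_sym gf1.
by move=> h; rewrite !inE mem_enum inE => /orP[]/eqP -> /=; rewrite ?f1s ?gs.
Qed.

Lemma bd_exists f : exists x y, bd f x y.
Proof.
have [/existsP[x /existsP[y fxy]]|/existsPn nof] :=
  boolP [exists x, [exists y, bd f x y]]; first by exists x, y.
have /(leq_trans many_faces) : #|F| <= 1 => //.
apply: (@bd_closed [:: f] f); first by rewrite inE.
move=> g x y; rewrite inE => /eqP-> fxy.
by have /existsPn/(_ y)/negP := nof x.
Qed.

(* [dart_cases] splits the membership of a pair in an explicit list;
   [dart_uniq] evaluates such a membership from the known disequalities. *)
Ltac dart_cases := rewrite /darts_of /= ?inE ?xpair_eqE;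
  repeat (case/orP); try (move=> /andP[/eqP ? /eqP ?]; subst).

Ltac dart_uniq := rewrite /darts_of /= ?inE ?xpair_eqE ?negb_or ?negb_and;
  repeat match goal with
  | H : is_true (?x != ?y) |- context [?x == ?y] => rewrite (negbTE H)
  | H : is_true (?x != ?y) |- context [?y == ?x] => rewrite (eq_sym y x) (negbTE H)
  end; rewrite /= ?orbT ?andbT ?orbF ?andbF ?eqxx //=.

Lemma nb_darts_ge6 f : 6 <= nb_darts f.
Proof.
have [a [b fab]] := bd_exists f; have nab := bd_neq fab.
have [c nca fbc] := bd_next fab; have nbc := bd_neq fbc.
have fba : bd f b a by rewrite bdC.
have [d ndb fad] := bd_next fba; have nad := bd_neq fad.
apply: (@darts_leq f [:: (a, b); (b, c); (a, d)]); first by rewrite /= fab fbc fad.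
by dart_uniq.
Qed.

(** Each edge of a face counts for two ordered pairs, hence sizes 6, 8 and >= 10. *)
Definition tri f := nb_darts f == 6.
Definition quad f := nb_darts f == 8.
Definition big f := 10 <= nb_darts f.

Definition tri_on f a b c := [/\ tri f, bd f a b, bd f b c & bd f c a].

Definition quad_on f a b c d :=
  [/\ quad f, bd f a b, bd f b c & bd f c d /\ bd f d a].

Lemma tri_onP f a b : tri f -> bd f a b -> exists c, tri_on f a b c.
Proof.
move=> tf fab; have nab := bd_neq fab.
have [c nca fbc] := bd_next fab; have nbc := bd_neq fbc.
have fba : bd f b a by rewrite bdC.
have [d ndb fad] := bd_next fba; have nad := bd_neq fad.
have [e|ncd] := eqVneq c d; first by subst d; exists c; split; rewrite // bdC.
have D : forall x y, bd f x y = ((x, y) \in darts_of [:: (a, b); (b, c); (a, d)]).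
  apply: darts_eq; [by rewrite /= fab fbc fad| |by apply/eqP].
  by dart_uniq.
have [e neb fce] := bd_next fbc; have := fce; rewrite D.
by dart_cases; rewrite ?eqxx // in nca nbc nab ncd neb.
Qed.

Lemma tri_darts f a b c : tri_on f a b c ->
  forall x y, bd f x y = ((x, y) \in darts_of [:: (a, b); (b, c); (c, a)]).
Proof.
case=> /eqP tf fab fbc fca; have [nab nbc nca] := And3 (bd_neq fab) (bd_neq fbc) (bd_neq fca).
by apply: darts_eq => //=; rewrite ?fab ?fbc ?fca //; dart_uniq.
Qed.

(** A set of four edges with even degrees is a 4-cycle: the other possibility would
    be a triangle and a further edge. *)
Lemma quad_onP f a b : quad f -> bd f a b ->
  exists c d, [/\ quad_on f a b c d, a != c & b != d].
Proof.
move=> qf fab; have nab := bd_neq fab.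
have [c nca fbc] := bd_next fab; have nbc := bd_neq fbc.
have fba : bd f b a by rewrite bdC.
have [d ndb fad] := bd_next fba; have nad := bd_neq fad.
have [e|ncd] := eqVneq c d.
  subst d; have us : uniq (darts_of [:: (a, b); (b, c); (c, a)]) by dart_uniq.
  have fs : all (fun p => bd f p.1 p.2) [:: (a, b); (b, c); (c, a)].
    by rewrite /= fab fbc bdC fad.
  have [[x y] /andP[/= fxy nxy]] : exists p : dart,
      bd f p.1 p.2 && (p \notin darts_of [:: (a, b); (b, c); (c, a)]).
    apply/existsP; apply: contraT => /existsPn sub.
    have : nb_darts f <= 6.
      rewrite /nb_darts cardE -[6]/(size (darts_of [:: (a, b); (b, c); (c, a)])).
      apply: uniq_leq_size; first exact: enum_uniq.
      by move=> p; rewrite mem_enum inE => fp; have := sub p; rewrite fp negbK.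
    by move: qf; rewrite /quad => /eqP->.
  have out_tri u v : bd f u v -> u \notin [:: a; b; c] -> False.
    move=> fuv; rewrite !inE !negb_or => /and3P[nua nub nuc].
    have nuv := bd_neq fuv; have fvu : bd f v u by rewrite bdC.
    have [w nwv fuw] := bd_next fvu; have nuw := bd_neq fuw.
    have : 2 * 5 <= nb_darts f.
      apply: (@darts_leq f [:: (a, b); (b, c); (c, a); (u, v); (u, w)]).
        by rewrite /= fab fbc (bdC f c a) fad fuv fuw.
      by dart_uniq.
    by move: qf; rewrite /quad => /eqP->.
  have fyx : bd f y x by rewrite bdC.
  have xin : x \in [:: a; b; c] by apply: contraT => /(out_tri _ _ fxy).
  have yin : y \in [:: a; b; c] by apply: contraT => /(out_tri _ _ fyx).
  case/negP: nxy; move: xin yin (bd_neq fxy); rewrite !inE.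
  by case/or3P => /eqP ->; case/or3P => /eqP ->; rewrite ?eqxx // !xpair_eqE !eqxx ?orbT.
have [e neb fce] := bd_next fbc; have nce := bd_neq fce.
have [ed|ned] := eqVneq e d.
  subst e; exists c, d; split; rewrite 1?eq_sym //; split=> //; split=> //.
  by rewrite bdC.
exfalso.
have D : forall x y, bd f x y = ((x, y) \in darts_of [:: (a, b); (b, c); (a, d); (c, e)]).
  apply: darts_eq; [by rewrite /= fab fbc fad fce| |exact/eqP].
  by dart_uniq.
have [g nga fdg] := bd_next fad; have := fdg; rewrite D.
by dart_cases; rewrite ?eqxx // in nca nbc nab ncd neb nga ned nad ndb nce.
Qed.

Lemma quad_darts f a b c d : quad_on f a b c d -> a != c -> b != d ->
  forall x y, bd f x y = ((x, y) \in darts_of [:: (a, b); (b, c); (c, d); (d, a)]).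
Proof.
case=> /eqP qf fab fbc [fcd fda] nac nbd.
have [nab nbc] := conj (bd_neq fab) (bd_neq fbc).
have [ncd nda] := conj (bd_neq fcd) (bd_neq fda).
apply: darts_eq => //=; first by rewrite fab fbc fcd fda.
by dart_uniq.
Qed.

Lemma face_size f : [|| tri f, quad f | big f].
Proof.
have := nb_darts_ge6 f; have := nb_darts_even f; rewrite /tri /quad /big.
by case: (nb_darts f) => [|[|[|[|[|[|[|[|[|[|n]]]]]]]]]].
Qed.

(** * The discharging procedure *)

Definition bdp f : pred dart := fun p => bd f p.1 p.2.

Definition cnt (P : pred F) (p : dart) := #|[pred f | P f && bdp f p]|.

(** What a triangle receives through a pair p.  All charges are multiplied by 4
    and shared between the two orientations of an edge, so that 1/2 becomes 1 and
    1 becomes 2; a missing second face counts as a long one.  If p lies on two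
    triangles, then the value is 0. *)
Definition rho p := cnt quad p + 2 * cnt big p + 2 * (2 - cnt predT p).

Definition shared f g := #|[pred p | bdp f p && bdp g p]|.

(** A quadrilateral that shares two edges (four pairs) with T also gives T what it
    does not give through its other edges. *)
Definition extra T :=
  \sum_(f | quad f && (shared f T == 4)) \sum_(p | bdp f p) (cnt tri p == 0).

Definition received T := \sum_(p | bdp T p) rho p + extra T.

Definition nb_glued T := \sum_(p | bdp T p) (cnt tri p == 2).

(** A rich triangle is glued to exactly one other triangle.  It needs 4 and
    receives at least 6, and it passes 2 to its neighbour, 1 through each
    orientation of the common edge. *)
Definition rich T := [&& tri T, nb_glued T == 2 & 6 <= received T].

Definition given_to T :=
  \sum_(p | bdp T p) \sum_(T' | [&& rich T', T' != T & bdp T' p]) 1.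

Lemma cnt_le2 P p : cnt P p <= 2.
Proof.
apply: leq_trans (bd_le2 p.1 p.2); apply: subset_leq_card.
by apply/subsetP => f; rewrite !inE => /andP[].
Qed.

Lemma cnt_all p : cnt predT p = cnt tri p + cnt quad p + cnt big p.
Proof.
rewrite /cnt -!sum1_card [LHS](bigID tri) /= -addnA; congr (_ + _).
  by apply: eq_bigl => f; rewrite !inE andbC.
rewrite (bigID quad) /=; congr (_ + _); apply: eq_bigl => f; rewrite !inE;
  have := face_size f; rewrite /tri /quad /big; case: (bdp f p); lia.
Qed.

Lemma double_count (P : pred F) (G : dart -> nat) :
  \sum_(f | P f) \sum_(p | bdp f p) G p = \sum_p cnt P p * G p.
Proof.
rewrite (exchange_big_dep predT) //=; apply: eq_bigr => p _.
rewrite sum_nat_const; congr (_ * _); exact: eq_card.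
Qed.

Lemma sum_nb_darts (P : pred F) : \sum_(f | P f) nb_darts f = \sum_p cnt P p.
Proof.
have := double_count P (fun=> 1); under eq_bigr do rewrite sum1_card.
by move->; under eq_bigr do rewrite muln1.
Qed.

Lemma sum_given : \sum_(T | tri T) given_to T <= 2 * #|[pred T | rich T]|.
Proof.
rewrite mulnC -sum_nat_const /=.
have -> : \sum_(T | tri T) given_to T =
    \sum_(T' | rich T') \sum_(p | bdp T' p) \sum_(T | [&& tri T, T' != T & bdp T p]) 1.
  have givenE T : given_to T =
      \sum_(T' | rich T') \sum_(p | [&& bdp T p, T' != T & bdp T' p]) 1.
    rewrite /given_to (exchange_big_dep rich) /= => [|p T' _ /and3P[] //].
    apply: eq_bigr => T' rT'; apply: eq_bigl => p; by rewrite rT'.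
  rewrite (eq_bigr _ (fun T _ => givenE T)) exchange_big /=; apply: eq_bigr => T' _.
  rewrite [RHS](exchange_big_dep tri) /= => [|p T _ /and3P[] //].
  apply: eq_bigr => T tT; apply: eq_bigl => p; rewrite tT /=.
  by case: (bdp T p); case: (bdp T' p); case: (T' != T).
apply: leq_sum => T' /and3P[tT' /eqP glued _]; rewrite -glued; apply: leq_sum => p Tp.
have c2 := cnt_le2 tri p; have := cardD1 T' [pred f | tri f && bdp f p].
rewrite inE tT' Tp -/(cnt tri p) => c1; rewrite sum1_card.
rewrite (_ : #|_| = #|[predD1 [pred f | tri f && bdp f p] & T']|); last first.
  by apply: eq_card => T; rewrite !inE eq_sym andbCA.
by move: c2; rewrite c1; case: #|_| => [|[|]].
Qed.

(** If two triangles share two edges each with f, then no edge of f is left to give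
    anything; otherwise at most one triangle receives an extra from f. *)
Lemma sum_extra_le f : quad f ->
  \sum_(T | tri T && (shared f T == 4)) \sum_(p | bdp f p) (cnt tri p == 0)
    <= \sum_(p | bdp f p) (cnt tri p == 0).
Proof.
move=> qf; rewrite sum_nat_const; set s := \sum_(p | _) _.
have [->|s_pos] := posnP s; first by rewrite muln0.
rewrite -[leqRHS]mul1n leq_mul2r; apply/orP; right.
rewrite leqNgt; apply/negP => /card_gt1P[T [T' [/andP[tT sT] /andP[tT' sT'] nTT']]].
have [p fp cp] : exists2 p, bdp f p & cnt tri p == 0.
  move: s_pos; rewrite lt0n sum_nat_eq0 => /forall_inPn[p fp].
  by rewrite eqb0 negbK; exists p.
suff : 8 < nb_darts f by move: qf; rewrite /quad => /eqP->.
have nf T0 : tri T0 -> f != T0.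
  by apply: contraTneq => <-; rewrite /tri; move: qf; rewrite /quad => /eqP->.
have no3 q T0 : tri T0 -> bdp T0 q -> q != p.
  move=> tT0 T0q; apply: contraTneq cp => e; rewrite -lt0n; apply/card_gt0P.
  by exists T0; rewrite inE -e tT0.
have := cardUI [pred q | bdp f q && bdp T q] [pred q | bdp f q && bdp T' q].
rewrite [X in _ = X + _](eqP sT) [X in _ = _ + X](eqP sT').
rewrite (eq_card0 (A := [predI _ & _])) ?addn0; last first.
  move=> q; rewrite !inE; apply/negP => /andP[/andP[fq Tq] /andP[_ T'q]].
  exact: (bd_full fq Tq T'q (nf _ tT) nTT' (nf _ tT')).
move=> e8; rewrite /nb_darts (cardD1 p) inE -[bd _ _ _]/(bdp f p) fp ltnS.
rewrite -[4 + 4]/8 in e8; rewrite -e8; apply: subset_leq_card; apply/subsetP => q.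
by rewrite !inE => /orP[]/andP[fq Tq]; rewrite (fq : bd f q.1 q.2) andbT; apply: no3 Tq.
Qed.

Lemma sum_received_le :
  \sum_(T | tri T) received T <=
    \sum_(p : dart | adj p.1 p.2) (cnt quad p + 2 * cnt big p + 2 * (2 - cnt predT p)).
Proof.
rewrite big_split /= double_count.
have -> : \sum_(T | tri T) extra T = \sum_(f | quad f)
    \sum_(T | tri T && (shared f T == 4)) \sum_(p | bdp f p) (cnt tri p == 0).
  rewrite /extra (exchange_big_dep quad) /= => [|T f _ /andP[] //].
  by apply: eq_bigr => f qf; apply: eq_bigl => T; rewrite qf.
apply: (@leq_trans (\sum_p cnt tri p * rho p +
   \sum_(f | quad f) \sum_(p | bdp f p) (cnt tri p == 0))).
  by rewrite leq_add2l; apply: leq_sum => f; apply: sum_extra_le.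
rewrite double_count -big_split /= [leqRHS]big_mkcond /=; apply: leq_sum => p _.
have [_|nadj] := boolP (adj p.1 p.2).
  have := cnt_all p; have := cnt_le2 predT p; rewrite /rho.
  by case: (cnt tri p) => [|[|[|n]]]; lia.
have no P : cnt P p = 0.
  apply: eq_card0 => f; rewrite !inE; apply/negP => /andP[_ /bd_adj].
  exact/negP.
by rewrite /rho !no.
Qed.

(** The conclusion says that the charges 3k - 10 of the faces, together with 3 for
    each missing second face of an edge, have a nonnegative sum. *)
Theorem faces_le_darts :
  (forall T, tri T -> 4 + 2 * rich T <= received T + given_to T) ->
  10 * #|F| <= 3 * #|[pred p : dart | adj p.1 p.2]|.
Proof.
move=> loc; set M := #|[pred p : dart | _]|.
have split_faces : #|F| = #|[pred f | tri f]| + #|[pred f | quad f]| + #|[pred f | big f]|.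
  rewrite -!sum1_card (bigID tri) /= -addnA; congr (_ + _).
  rewrite (bigID quad) /=; congr (_ + _); apply: eq_bigl => f; rewrite !inE;
    have := face_size f; rewrite /tri /quad /big; lia.
have sumT : \sum_p cnt tri p = 6 * #|[pred f | tri f]|.
  rewrite -sum_nb_darts mulnC -sum_nat_const; apply: eq_bigr => f; exact/eqP.
have sumQ : \sum_p cnt quad p = 8 * #|[pred f | quad f]|.
  rewrite -sum_nb_darts mulnC -sum_nat_const; apply: eq_bigr => f; exact/eqP.
have sumB : 10 * #|[pred f | big f]| <= \sum_p cnt big p.
  by rewrite -sum_nb_darts mulnC -sum_nat_const; apply: leq_sum.
have on_adj P : \sum_(p : dart | adj p.1 p.2) cnt P p = \sum_p cnt P p.
  rewrite big_mkcond; apply: eq_bigr => p _; case: ifP => // /negP nadj.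
  apply/esym/eq_card0 => f; rewrite !inE; apply/negP => /andP[_ /bd_adj].
  exact: nadj.
have sumall : \sum_(p : dart | adj p.1 p.2) (2 - cnt predT p) +
    (\sum_p cnt tri p + \sum_p cnt quad p + \sum_p cnt big p) = 2 * M.
  rewrite mulnC -sum_nat_const -!on_adj -!big_split /=; apply: eq_bigr => p _.
  by rewrite -cnt_all subnK ?cnt_le2.
have sum_rich : \sum_(T | tri T) rich T = #|[pred T | rich T]|.
  rewrite -sum1_card [RHS]big_mkcond [LHS]big_mkcond /=; apply: eq_bigr => f _.
  by rewrite inE /rich; case: (tri f).
have lower : #|[pred T | tri T]| * 4 + 2 * #|[pred T | rich T]| <=
    \sum_(T | tri T) received T + \sum_(T | tri T) given_to T.
  rewrite -sum_rich big_distrr -sum_nat_const -!big_split; exact: leq_sum.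
have upper : \sum_(T | tri T) received T <= \sum_p cnt quad p
    + 2 * (\sum_p cnt big p) + 2 * (\sum_(p : dart | adj p.1 p.2) (2 - cnt predT p)).
  apply: leq_trans sum_received_le _.
  by rewrite 2!big_split -!big_distrr /= [X in X + _ + _]on_adj [X in _ + _ * X + _]on_adj.
have := sum_given; lia.
Qed.

(** * Every triangle gets enough charge *)

Lemma adj_neq x y : adj x y -> x != y.
Proof. by apply: contraTneq => ->; rewrite adjxx. Qed.

Lemma bd_adj2 f x y : bd f x y -> adj x y /\ adj y x.
Proof. by move=> /bd_adj xy; rewrite [adj y x]adjC. Qed.

Lemma cntC P x y : cnt P (x, y) = cnt P (y, x).
Proof. by apply: eq_card => f; rewrite !inE /bdp /= bdC. Qed.

Lemma rhoC x y : rho (x, y) = rho (y, x).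
Proof. by rewrite /rho !(cntC _ x). Qed.

Lemma tri_on_rot T a b c : tri_on T a b c -> tri_on T b c a.
Proof. by case. Qed.

Lemma tri_on_flip T a b c : tri_on T a b c -> tri_on T b a c.
Proof. by case=> tT ab bc ca; split=> //; rewrite bdC. Qed.

Lemma tri_adj T a b c : tri_on T a b c -> [/\ tri T, adj a b /\ adj b a,
  adj b c /\ adj c b & adj c a /\ adj a c].
Proof. by case=> tT ab bc ca; split=> //; apply: bd_adj2; eassumption. Qed.

Lemma quad_adj f a b c d : quad_on f a b c d -> [/\ quad f, adj a b /\ adj b a,
  adj b c /\ adj c b & (adj c d /\ adj d c) /\ (adj d a /\ adj a d)].
Proof.
case=> qf ab bc [cd da]; split=> //; last split; apply: bd_adj2; eassumption.
Qed.

Lemma tri_sum T a b c (G : dart -> nat) : tri_on T a b c ->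
  (forall x y, G (x, y) = G (y, x)) ->
  \sum_(p | bdp T p) G p = 2 * (G (a, b) + G (b, c) + G (c, a)).
Proof.
move=> Tabc GC; have [_ fab fbc fca] := Tabc.
have [nab nbc nca] := And3 (bd_neq fab) (bd_neq fbc) (bd_neq fca).
rewrite (eq_bigl (mem (darts_of [:: (a, b); (b, c); (c, a)]))); last first.
  by move=> [x y]; apply: (tri_darts Tabc).
rewrite -big_uniq; last by dart_uniq.
by rewrite /= !big_cons big_nil (GC b a) (GC c b) (GC a c); lia.
Qed.

Lemma cnt_tri_pos T x y : tri T -> bd T x y -> 0 < cnt tri (x, y).
Proof. by move=> tT Txy; apply/card_gt0P; exists T; rewrite inE tT. Qed.

Lemma cnt_tri1 T x y : tri T -> bd T x y ->
  (forall T', tri T' -> bd T' x y -> T' != T -> False) -> cnt tri (x, y) = 1.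
Proof.
move=> tT Txy only; apply: (@eq_card1 _ T) => T'; rewrite !inE.
apply/andP/eqP => [[tT' T'xy]|->] //.
by apply/eqP; apply: contraT => /(only _ tT' T'xy).
Qed.

(** Another triangle on the edge ab has another apex: two faces with the same
    boundary would be all the faces. *)
Lemma glued T a b c : tri_on T a b c -> cnt tri (a, b) != 1 ->
  exists T' x, [/\ T' != T, tri_on T' a b x & x != c].
Proof.
move=> Tabc; have [tT Tab _ _] := Tabc.
have [/exists_inP[T' tT' /andP[T'ab nT']] _|no] :=
    boolP [exists (T' | tri T'), bd T' a b && (T' != T)]; last first.
  case/eqP; apply: cnt_tri1 Tab _ => // T' tT' T'ab nT'.
  by case/exists_inP: no; exists T'; rewrite ?T'ab.
have [x T'abx] := tri_onP tT' T'ab; exists T', x; split=> //.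
apply/eqP => e; subst x; have same x y : bd T x y = bd T' x y.
  by rewrite (tri_darts Tabc) (tri_darts T'abx).
suff clos f u v : f \in [:: T; T'] -> bd f u v ->
    exists2 g, g \in [:: T; T'] & (g != f) && bd g u v.
  by have /(leq_trans many_faces) := bd_closed (mem_head T [:: T']) clos.
have inT' : T' \in [:: T; T'] by rewrite !inE eqxx orbT.
rewrite !inE => /orP[]/eqP -> fuv; [exists T'|exists T] => //.
- by rewrite nT' -same.
- by rewrite mem_head.
- by rewrite eq_sym nT' same.
Qed.

Lemma rho_ge1 x y : cnt tri (x, y) = 1 -> 1 <= rho (x, y).
Proof. by have := cnt_all (x, y); rewrite /rho; lia. Qed.

Lemma rho_ge2 x y : cnt tri (x, y) = 1 -> (forall f, quad f -> bd f x y -> False) ->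
  2 <= rho (x, y).
Proof.
move=> t1 noq; have : cnt quad (x, y) = 0.
  by apply: eq_card0 => f; rewrite !inE; apply/negP => /andP[]; apply: noq.
by have := cnt_all (x, y); rewrite /rho; lia.
Qed.

Lemma rho_lt2 x y : cnt tri (x, y) = 1 -> rho (x, y) < 2 ->
  exists2 f, quad f & bd f x y.
Proof.
move=> t1 r; apply/exists_inP; apply: contraLR r => /exists_inPn no.
by rewrite -leqNgt rho_ge2 // => f qf; apply/negP/no.
Qed.

Lemma tri_quad f g : tri f -> quad g -> f != g.
Proof. by move=> tf; apply: contraTneq => <-; move: tf; rewrite /tri /quad => /eqP->. Qed.

(* [ne] proves a disequality; [full x y f g h] concludes from three faces on the
   edge xy; [domino u v p q p' q'] from the 4-cycles u v p q and u v p' q' whose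
   intersection is the edge uv. *)
Ltac ne := first [done | by rewrite eq_sym | by apply: adj_neq
  | by apply: tri_quad | by rewrite eq_sym; apply: tri_quad].
Ltac full x y f g h := exfalso; apply: (@bd_full x y f g h); first [ne | by rewrite bdC].
Ltac domino u v p q p' q' := exfalso; apply: (@no_theta u v p q p' q') => //;
  rewrite /= !inE !negb_or; repeat (apply/andP; split); try ne.

(** Three triangles x a b, a b c, b c y turn around b.  A quadrilateral f on the
    edge ac must meet both {b, x} and {b, y}, and it avoids b because ab and bc
    already have two faces; so f is the 4-cycle a c y x.  A triangle on the other
    side of bx would be b x y, and then these five faces would be all the faces, or
    it would give a fan of four triangles, which contains Theta.  A quadrilateral
    on that side would give Theta too.  So the triangle abx receives 4 through bx
    and 2 through xa. *)
Lemma fan_rich T T1 T2 f a b c x y :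
  tri_on T a b c -> tri_on T1 a b x -> tri_on T2 b c y -> quad f -> bd f a c ->
  T1 != T -> T2 != T -> x != c -> y != a -> rich T1.
Proof.
move=> Tabc T1abx T2bcy qf fac nT1 nT2 nxc nya.
have [tT [ab ba] [bc cb] [ca ac]] := tri_adj Tabc.
have [tT1 _ [bx xb] [xa ax]] := tri_adj T1abx.
have [tT2 _ [cy yc] [yb by_]] := tri_adj T2bcy.
have [_ Tab Tbc Tca] := Tabc; have [_ T1ab T1bx T1xa] := T1abx.
have [_ T2bc T2cy T2yb] := T2bcy.
have nxy : x != y by apply/eqP => e; subst y; exact: (@noK4 a b c x).
have ncx : ~ adj c x by move=> cx; apply: (@noK4 a b c x).
have nay : ~ adj a y by move=> ay; apply: (@noK4 a b c y).
have [nab nbc nca] := And3 (adj_neq ab) (adj_neq bc) (adj_neq ca).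
have [nbx nxa] := conj (adj_neq bx) (adj_neq xa).
have [ncy nyb] := conj (adj_neq cy) (adj_neq yb).
have nT12 : T1 != T2.
  by apply: contraTneq T1xa => ->; rewrite (tri_darts T2bcy); dart_uniq.
have [p [q [facpq nap ncq]]] := quad_onP qf fac.
have [_ [_ _] [cp pc] [[pq qp] [qa aq]]] := quad_adj facpq.
have [_ _ fcp [fpq fqa]] := facpq.
have nqb : q != b by apply/eqP => e; subst q; full a b f T T1.
have npb : p != b by apply/eqP => e; subst p; full b c f T T2.
have npx : p != x by apply/eqP => e; subst p; case: ncx.
have nqy : q != y by apply/eqP => e; subst q; case: nay.
have eqx : q = x by apply/eqP; apply: contraT => nqx; domino a c p q b x.
have epy : p = y by apply/eqP; apply: contraT => npy; domino a c p q y b.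
subst p q => {nqb npb npx nqy}.
have fD := quad_darts facpq nap ncq.
have nt_xa : cnt tri (x, a) = 1.
  by apply: (cnt_tri1 tT1 T1xa) => T' tT' T'xa nT'; full x a f T' T1.
have nt_bx : cnt tri (b, x) = 1.
  apply/eqP; apply: contraT => /(glued (tri_on_rot T1abx))[T4 [w [nT4 T4bxw nwa]]].
  have [tT4 _ [xw wx] [wb bw]] := tri_adj T4bxw; have [_ T4bx T4xw T4wb] := T4bxw.
  have nwc : w != c by apply/eqP => e; subst w.
  have [e|nwy] := eqVneq w y; last by domino b a x w c y.
  subst w; have := @bd_closed [:: T; T1; T2; f; T4] T (mem_head _ _).
  have nT4f : f != T4 by ne.
  have nTf : f != T by ne. have nT1f : f != T1 by ne. have nT2f : f != T2 by ne.
  have nT4T : T4 != T.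
    by apply: contraTneq T4bx => ->; rewrite (tri_darts Tabc); dart_uniq.
  have nT4T2 : T4 != T2.
    by apply: contraTneq T4bx => ->; rewrite (tri_darts T2bcy); dart_uniq.
  suff clos : forall g u v, g \in [:: T; T1; T2; f; T4] -> bd g u v ->
      exists2 h, h \in [:: T; T1; T2; f; T4] & (h != g) && bd h u v.
    by move=> /(_ clos) /(leq_trans many_faces).
  have by_ex h g u v : h \in [:: T; T1; T2; f; T4] -> h != g -> bd h u v ->
      exists2 h, h \in [:: T; T1; T2; f; T4] & (h != g) && bd h u v.
    by move=> hs hg huv; exists h; rewrite ?hg.
  have inT : T \in [:: T; T1; T2; f; T4] by rewrite !inE eqxx.
  have inT1 : T1 \in [:: T; T1; T2; f; T4] by rewrite !inE eqxx ?orbT.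
  have inT2 : T2 \in [:: T; T1; T2; f; T4] by rewrite !inE eqxx ?orbT.
  have inf : f \in [:: T; T1; T2; f; T4] by rewrite !inE eqxx ?orbT.
  have inT4 : T4 \in [:: T; T1; T2; f; T4] by rewrite !inE eqxx ?orbT.
  have rev g u v : bd g u v -> bd g v u by rewrite bdC.
  have [Tba Tcb Tac] := And3 (rev _ _ _ Tab) (rev _ _ _ Tbc) (rev _ _ _ Tca).
  have [T1ba T1xb T1ax] := And3 (rev _ _ _ T1ab) (rev _ _ _ T1bx) (rev _ _ _ T1xa).
  have [T2cb T2yc T2by] := And3 (rev _ _ _ T2bc) (rev _ _ _ T2cy) (rev _ _ _ T2yb).
  have [T4xb T4wx T4bw] := And3 (rev _ _ _ T4bx) (rev _ _ _ T4xw) (rev _ _ _ T4wb).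
  have [fca fpc] := conj (rev _ _ _ fac) (rev _ _ _ fcp).
  have [fqp faq] := conj (rev _ _ _ fpq) (rev _ _ _ fqa).
  move=> g u v; rewrite !inE => /or4P[|||/orP[]] /eqP -> {g}.
  - rewrite (tri_darts Tabc); dart_cases;
    first [apply: (by_ex T1); solve [ne|assumption] | apply: (by_ex T2); solve [ne|assumption] | apply: (by_ex f); solve [ne|assumption]].
  - rewrite (tri_darts T1abx); dart_cases;
    first [apply: (by_ex T); solve [ne|assumption] | apply: (by_ex T4); solve [ne|assumption] | apply: (by_ex f); solve [ne|assumption]].
  - rewrite (tri_darts T2bcy); dart_cases;
    first [apply: (by_ex T); solve [ne|assumption] | apply: (by_ex T4); solve [ne|assumption] | apply: (by_ex f); solve [ne|assumption]].
  - rewrite fD; dart_cases;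
    first [apply: (by_ex T); solve [ne|assumption] | apply: (by_ex T4); solve [ne|assumption] | apply: (by_ex T1); solve [ne|assumption] | apply: (by_ex T2); solve [ne|assumption]].
  - rewrite (tri_darts T4bxw); dart_cases;
    first [apply: (by_ex T1); solve [ne|assumption] | apply: (by_ex T2); solve [ne|assumption] | apply: (by_ex f); solve [ne|assumption]].
have nt_ab : cnt tri (a, b) = 2.
  apply/eqP; rewrite eqn_leq cnt_le2 /= /cnt cardE.
  apply: (@uniq_leq_size _ [:: T; T1]); first by rewrite /= inE eq_sym nT1.
  by move=> g; rewrite !inE mem_enum inE => /orP[]/eqP -> /=; rewrite ?tT ?tT1.
have rho_bx : 2 <= rho (b, x).
  apply: rho_ge2 nt_bx _ => g qg gbx.
  have nfg : f != g.
    by apply: contraTneq gbx => <-; rewrite fD; dart_uniq.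
  have gxb : bd g x b by rewrite bdC.
  have [p [q [gbxpq nbp nxq]]] := quad_onP qg gbx.
  have [_ _ [xp px] [[pq' qp'] [qb bq]]] := quad_adj gbxpq.
  have [_ _ gxp [gpq gqb]] := gbxpq.
  have npa : p != a by apply/eqP => e; subst p; full x a g f T1.
  have nqa : q != a by apply/eqP => e; subst q; full a b g T T1.
  have npc : p != c by apply/eqP => e; subst p; case: ncx.
  have nqc : q != c by apply/eqP => e; subst q; full b c g T T2.
  domino b x p q a c.
apply/and3P; split=> //.
  rewrite /nb_glued (tri_sum (G := fun p => cnt tri p == 2) T1abx) ?nt_ab ?nt_bx ?nt_xa //.
  by move=> u v; rewrite cntC.
apply: leq_trans (leq_addr _ _); rewrite (tri_sum T1abx rhoC).
by move: rho_bx (rho_ge1 nt_xa); clear; lia.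
Qed.

(** A triangle abc glued on all its sides has neighbours that are glued to no other
    triangle: a further triangle on xa would form a fan of four triangles around a,
    or a wheel around a to which the triangle bcy is attached, and both contain
    Theta. *)
Lemma sun_unglued T T1 T2 T3 a b c x y z :
  tri_on T a b c -> tri_on T1 a b x -> tri_on T2 b c y -> tri_on T3 c a z ->
  T1 != T -> T2 != T -> T3 != T -> x != c -> y != a -> z != b ->
  cnt tri (x, a) = 1.
Proof.
move=> Tabc T1abx T2bcy T3caz nT1 nT2 nT3 nxc nya nzb.
have [tT [ab ba] [bc cb] [ca ac]] := tri_adj Tabc.
have [tT1 _ [bx xb] [xa ax]] := tri_adj T1abx.
have [tT2 _ [cy yc] [yb by_]] := tri_adj T2bcy.
have [tT3 _ [az za] [zc cz]] := tri_adj T3caz.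
have nxz : x != z by apply/eqP => e; subst z; exact: (@noK4 a b c x).
have nxy : x != y by apply/eqP => e; subst y; exact: (@noK4 a b c x).
have nyz : y != z by apply/eqP => e; subst z; exact: (@noK4 a b c y).
apply/eqP; apply: contraT.
move=> /(glued (tri_on_rot (tri_on_rot T1abx)))[T4 [w [nT4 T4xaw nwb]]].
have [tT4 _ [aw wa] [wx xw]] := tri_adj T4xaw.
have nwc : w != c by apply/eqP => e; subst w; case: (@noK4 a b c x).
have [e|nwz] := eqVneq w z; last by domino a b x w c z.
by subst w; domino a b x z y c.
Qed.

(** A quadrilateral f on the edge xa of the neighbour abx must contain b, hence it is
    the 4-cycle a x b q.  No triangle lies on its edge aq, since together with abc
    and bcy it would give Theta, so f gives the triangle abx an extra. *)
Lemma sun_rich T T1 T2 T3 a b c x y z :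
  tri_on T a b c -> tri_on T1 a b x -> tri_on T2 b c y -> tri_on T3 c a z ->
  T1 != T -> T2 != T -> T3 != T -> x != c -> y != a -> z != b -> rich T1.
Proof.
move=> Tabc T1abx T2bcy T3caz nT1 nT2 nT3 nxc nya nzb.
have [tT [ab ba] [bc cb] [ca ac]] := tri_adj Tabc.
have [tT1 _ [bx xb] [xa ax]] := tri_adj T1abx.
have [tT2 _ [cy yc] [yb by_]] := tri_adj T2bcy.
have [tT3 _ [az za] [zc cz]] := tri_adj T3caz.
have [_ Tab Tbc Tca] := Tabc; have [_ T1ab T1bx T1xa] := T1abx.
have [_ T3ca _ _] := T3caz.
have [nab nbc nca] := And3 (adj_neq ab) (adj_neq bc) (adj_neq ca).
have [nbx nxa] := conj (adj_neq bx) (adj_neq xa).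
have nt_xa : cnt tri (x, a) = 1.
  exact: (sun_unglued Tabc T1abx T2bcy T3caz).
have nt_bx : cnt tri (b, x) = 1.
  rewrite cntC; exact: (sun_unglued (tri_on_flip Tabc) (tri_on_flip T1abx)
    (tri_on_flip T3caz) (tri_on_flip T2bcy)).
have nt_ab : cnt tri (a, b) = 2.
  apply/eqP; rewrite eqn_leq cnt_le2 /= /cnt cardE.
  apply: (@uniq_leq_size _ [:: T; T1]); first by rewrite /= inE eq_sym nT1.
  by move=> g; rewrite !inE mem_enum inE => /orP[]/eqP -> /=; rewrite ?tT ?tT1.
apply/and3P; split=> //.
  rewrite /nb_glued (tri_sum (G := fun p => cnt tri p == 2) T1abx) ?nt_ab ?nt_bx ?nt_xa //.
  by move=> u v; rewrite cntC.
have [r_xa r_bx] := conj (rho_ge1 nt_xa) (rho_ge1 nt_bx).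
rewrite /received (tri_sum T1abx rhoC).
have [r2|/(rho_lt2 nt_xa)[f qf fxa]] := leqP 2 (rho (x, a)).
  by move: r_bx r2; clear; lia.
suff : 2 <= extra T1 by move: r_xa r_bx; clear; lia.
have fax : bd f a x by rewrite bdC.
have [p [q [faxpq nap nxq]]] := quad_onP qf fax.
have [_ _ [xp px] [[pq qp] [qa aq]]] := quad_adj faxpq.
have [_ _ fxp [fpq fqa]] := faxpq.
have nqb : q != b by apply/eqP => e; subst q; full a b f T T1.
have nqc : q != c by apply/eqP => e; subst q; full c a f T T3.
have npc : p != c by apply/eqP => e; subst p; case: (@noK4 a b c x).
have epb : p = b by apply/eqP; apply: contraT => npb; domino a x p q b c.
subst p => {npc}.
have nqy : q != y by apply/eqP => e; subst q; case: (@noK4 a b c y).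
have fD := quad_darts faxpq nap nxq.
have nt_aq : cnt tri (a, q) = 0.
  apply/eqP; rewrite -leqn0 leqNgt; apply/negP => /card_gt0P[T5].
  rewrite inE => /andP[tT5 T5aq0]; have T5aq : bd T5 a q := T5aq0.
  have [w T5aqw] := tri_onP tT5 T5aq.
  have [_ _ [qw wq] [wa aw]] := tri_adj T5aqw; have [_ _ _ T5wa] := T5aqw.
  have nwb : w != b.
    apply/eqP => e; subst w; have nT5T : T5 != T.
      apply: contraTneq T5aq => ->; rewrite (tri_darts Tabc); dart_uniq.
    have nT5T1 : T5 != T1.
      by apply: contraTneq T5aq => ->; rewrite (tri_darts T1abx); dart_uniq.
    by full a b T5 T T1.
  have nwc : w != c by apply/eqP => e; subst w; case: (@noK4 a b c q).
  have nwy : w != y by apply/eqP => e; subst w; case: (@noK4 a b c y).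
  by domino a b q w y c.
have nxb : x != b by ne.
have nqa : q != a by ne.
have sh : shared f T1 == 4.
  rewrite /shared (@eq_card _ _ (mem (darts_of [:: (a, x); (x, b)]))).
    by rewrite (card_uniqP _) //; dart_uniq.
  move=> [u v]; rewrite !inE /bdp /= fD (tri_darts T1abx).
  apply/andP/idP => [[]|].
    by dart_cases; dart_uniq.
  by dart_cases; dart_uniq.
rewrite /extra (bigD1 f) /=; last by rewrite qf sh.
apply: leq_trans (leq_addr _ _).
have f_aq : bdp f (a, q) by rewrite /bdp bdC.
rewrite (bigD1 (a, q)) //= (bigD1 (q, a)) /=; last first.
  by rewrite xpair_eqE negb_and; apply/andP; split=> //; apply/orP; left; ne.
by rewrite (cntC _ q) nt_aq.
Qed.

(** A triangle glued to at most one other gets 4 through two of its sides; a fan or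
    a sun is completed by its rich neighbours. *)
Lemma local_bound T : tri T -> 4 + 2 * rich T <= received T + given_to T.
Proof.
move=> tT; have [rT|_] := boolP (rich T).
  by case/and3P: rT => _ _ r6; apply: leq_trans (leq_addr _ _).
rewrite muln0 addn0.
pose G p := \sum_(T' | [&& rich T', T' != T & bdp T' p]) 1.
have GC x y : G (x, y) = G (y, x).
  by apply: eq_bigl => T'; rewrite /bdp /= bdC.
have G_pos T' x y : rich T' -> T' != T -> bd T' x y -> 0 < G (x, y).
  by move=> rT' nT' T'xy; rewrite /G (bigD1 T') //= rT' nT'.
have rho_or_glued a b c : tri_on T a b c ->
    0 < rho (a, b) \/ exists T' x, [/\ T' != T, tri_on T' a b x & x != c].
  move=> Tabc; have [/rho_ge1|/(glued Tabc)] := eqVneq (cnt tri (a, b)) 1; by [left|right].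
have in_fan a b c T1 x T2 y : tri_on T a b c -> tri_on T1 a b x -> tri_on T2 b c y ->
    T1 != T -> T2 != T -> x != c -> y != a -> 0 < rho (c, a) ->
    4 <= received T + given_to T.
  move=> Tabc T1abx T2bcy nT1 nT2 nxc nya r1.
  have [_ _ _ Tca] := Tabc.
  rewrite /received /given_to (tri_sum Tabc rhoC) (tri_sum Tabc GC).
  have [r2|r2] := leqP 2 (rho (c, a)); first by move: r2; clear; lia.
  have t1 : cnt tri (c, a) = 1.
    apply/eqP; rewrite eqn_leq (cnt_tri_pos tT Tca) andbT leqNgt; apply/negP => t2.
    move: r1; rewrite /rho; have := cnt_all (c, a); have := cnt_le2 predT (c, a).
    by move: t2; clear; lia.
  have [f qf fca] := rho_lt2 t1 r2; have fac : bd f a c by rewrite bdC.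
  have := fan_rich Tabc T1abx T2bcy qf fac nT1 nT2 nxc nya.
  have [_ T1ab _ _] := T1abx => /G_pos /(_ nT1 T1ab).
  by move: r1; clear; lia.
have [a [b Tab]] := bd_exists T; have [c Tabc] := tri_onP tT Tab.
have Tbca := tri_on_rot Tabc; have Tcab := tri_on_rot Tbca.
have rE : received T = 2 * (rho (a, b) + rho (b, c) + rho (c, a)) + extra T.
  by rewrite /received (tri_sum Tabc rhoC).
have gE : given_to T = 2 * (G (a, b) + G (b, c) + G (c, a)).
  by rewrite /given_to (tri_sum Tabc GC).
case: (rho_or_glued _ _ _ Tabc) => [r1|[T1 [x [nT1 T1x nx]]]];
case: (rho_or_glued _ _ _ Tbca) => [r2|[T2 [y [nT2 T2y ny]]]];
case: (rho_or_glued _ _ _ Tcab) => [r3|[T3 [z [nT3 T3z nz]]]];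
  try by rewrite rE; try move: r1; try move: r2; try move: r3; clear; lia.
- exact: (in_fan b c a T2 y T3 z).
- exact: (in_fan c a b T3 z T1 x).
- exact: (in_fan a b c T1 x T2 y).
have [[_ T1ab _ _] [_ T2bc _ _] [_ T3ca _ _]] := And3 T1x T2y T3z.
have := G_pos _ _ _ (sun_rich Tabc T1x T2y T3z nT1 nT2 nT3 nx ny nz) nT1 T1ab.
have := G_pos _ _ _ (sun_rich Tbca T2y T3z T1x nT2 nT3 nT1 ny nz nx) nT2 T2bc.
have := G_pos _ _ _ (sun_rich Tcab T3z T1x T2y nT3 nT1 nT2 nz nx ny) nT3 T3ca.
by rewrite gE; clear; lia.
Qed.

Theorem faces_vs_darts : 10 * #|F| <= 3 * #|[pred p : dart | adj p.1 p.2]|.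
Proof. exact: faces_le_darts local_bound. Qed.

End Discharging.

(** * The upper bound *)

Section UpperBound.

Variable G : sgraph.

Lemma edgesP (E : {set G}) :
  reflect (exists x y, adj x y /\ E = [set x; y]%SET) (E \in edges G).
Proof.
rewrite inE; apply: (iffP existsP) => [[x /existsP[y /andP[xy /eqP->]]]|[x [y [xy ->]]]].
  by exists x, y.
by exists x; apply/existsP; exists y; rewrite xy eqxx.
Qed.

Lemma adj_diff (x y : G) : adj x y -> x != y.
Proof. by apply: contraTneq => ->; rewrite adj_irrefl. Qed.

Lemma handshake : #|[pred d : G * G | adj d.1 d.2]| = 2 * nb_edges G.
Proof.
rewrite mulnC -sum1_card /nb_edges -sum_nat_const.
rewrite (partition_big (fun d : G * G => [set d.1; d.2]%SET) (mem (edges G))) /=.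
  apply: eq_bigr => E /edgesP[x [y [xy ->]]]; have nxy := adj_diff xy.
  rewrite sum1_card (@eq_card _ _ (mem [:: (x, y); (y, x)])).
    by rewrite (card_uniqP _) //= inE xpair_eqE negb_and nxy.
  move=> [a b]; rewrite !inE /=; apply/andP/orP => [[ab /eqP e]|].
    have : a \in [set x; y]%SET by rewrite -e set21.
    have : b \in [set x; y]%SET by rewrite -e set22.
    rewrite !inE => /orP[]/eqP eb /orP[]/eqP ea; move: ab; rewrite inE ea eb /= ?adj_irrefl //.
      by right.
    by left.
  by case=> /eqP[-> ->]; rewrite inE /=; [rewrite xy|rewrite adj_sym xy setUC].
by move=> [x y] xy; apply/edgesP; exists x, y.
Qed.

Lemma has_K4 a b c d : adj a b -> adj a c -> adj a d -> adj b c -> adj b d ->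
  @adj G c d -> contains G (complete_graph 4).
Proof.
move=> ab ac ad bc bd cd; exists (fun i : 'I_4 => nth a [:: a; b; c; d] i).
have key (i j : 'I_4) : i != j -> adj (nth a [:: a; b; c; d] i) (nth a [:: a; b; c; d] j).
  case: i j => [[|[|[|[|]]]] //= ?] [[|[|[|[|]]]] //= ?] //= _; by rewrite // adj_sym.
split=> [i j e|i j /key //]; apply/eqP; apply: contraT => /key.
by rewrite e adj_irrefl.
Qed.

Lemma has_theta6 (u v p q p' q' : G) : uniq [:: u; v; p; q; p'; q'] ->
  adj u v -> adj v p -> adj p q -> adj q u -> adj v p' -> adj p' q' -> adj q' u ->
  contains G theta6.
Proof.
move=> uniq6 uv vp pq qu vp' pq' qu'.
pose s := [:: u; q; p; v; p'; q'].
have us : uniq s.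
  rewrite -(@perm_uniq _ [:: u; v; p; q; p'; q']) //.
  by apply/permP => P /=; lia.
exists (fun i : 'I_6 => nth u s i); split=> [i j /eqP|i j].
  by rewrite nth_uniq // => /eqP /val_inj.
rewrite /= /theta6_adj -!val_eqE /=.
case: i j => [[|[|[|[|[|[|]]]]]] //= ?] [[|[|[|[|[|[|]]]]]] //= ?] //= _; by rewrite // adj_sym.
Qed.

(** With f faces, e <= n + f - 2: this suffices if f < 6, and otherwise it is combined
    with 5f <= 3e. *)
Theorem planar_edge_bound (R : realType) : planar R G -> 6 <= #|G| ->
  ~ contains G (complete_graph 4) -> ~ contains G theta6 ->
  nb_edges G <= (5 * (#|G| - 2)) %/ 2.
Proof.
move=> /planar_grid_parts[N [p [p_surj pconn padj]]] n6 noK4 noTheta.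
have G0 : 0 < #|G| by apply: leq_trans n6.
have [P [bd [bd_adj bdC bd_even bd_le2 [euler indep]]]] :=
  grid_minor_faces (@adj_sym G) (@adj_irrefl G) G0 p_surj pconn padj.
move: euler; rewrite -(addnC 4) handshake => euler.
have [few|many] := ltnP #|P| 6; first by rewrite leq_divRL //; move: euler few n6; clear; lia.
have := faces_vs_darts (@adj_sym G) (@adj_irrefl G) bd_adj bdC bd_even bd_le2 indep many.
rewrite handshake leq_divRL // => fd.
suff : 10 * #|P| <= 3 * (2 * nb_edges G) by move: euler n6; clear; lia.
apply: fd => [a b c d ab ac ad bc bd' cd|u v q q1 q' q1' us h1 h2 h3 h4 h5 h6 h7].
  by apply: noK4; apply: (has_K4 ab ac ad bc bd' cd).
by apply: noTheta; apply: (has_theta6 us h1 h2 h3 h4 h5 h6 h7).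
Qed.

End UpperBound.

(** * The extremal graph *)

Section Extremal.

Variables p m : nat.

Definition double_fan : sgraph :=
  join (copies 2 (complete_graph 1))
       (disjoint_union (copies p (complete_graph 2)) (copies m (complete_graph 1))).

Definition pole (x : double_fan) : bool := if x is inl _ then true else false.

Lemma pole_indep (x y : double_fan) : adj x y -> ~~ (pole x && pole y).
Proof.
by case: x y => [[i a]|x] [[j b]|y] //=; rewrite /copies_adj /complete_adj (ord1 a) (ord1 b) /= andbF.
Qed.

Lemma pole_pigeon (x y z : double_fan) : x != y -> x != z -> y != z ->
  ~~ [&& pole x, pole y & pole z].
Proof.
case: x y z => [[i a]|x] [[j b]|y] [[k c]|z] //=.
rewrite (ord1 a) (ord1 b) (ord1 c) {a b c}.
have neq (s t : 'I_2) : inl (s, ord0) != inl (t, ord0) :> double_fan -> s != t :> nat.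
  by apply: contraNneq => /val_inj ->.
move=> /neq + /neq + /neq.
by case: i j k => [[|[|]] //= ?] [[|[|]] //= ?] [[|[|]] //= ?].
Qed.

Lemma rim_matching (x y z : double_fan) : adj x y -> adj x z -> y != z ->
  [|| pole x, pole y | pole z].
Proof.
case: x y z => [//|x] [//|y] [//|z] /=.
case: x y z => [[i a]|[i a]] [[j b]|[j b]] [[k c]|[k c]] //=; rewrite /copies_adj /complete_adj /=.
  move=> /andP[/eqP <-] nab /andP[/eqP <-] nac nbc.
  have {}nbc : b != c by apply: contraNneq nbc => ->.
  move: nab nac nbc; rewrite -!val_eqE.
  by case: a b c => [[|[|]] //= ?] [[|[|]] //= ?] [[|[|]] //= ?].
by rewrite (ord1 a) (ord1 b) andbF.
Qed.

(** Whatever vertices of the copy are poles, one of the facts [pole_indep],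
    [pole_pigeon] and [rim_matching] is violated; the same holds for Theta. *)
Lemma double_fan_no_K4 : ~ contains double_fan (complete_graph 4).
Proof.
move=> [f [f_inj f_adj]].
pose v k := f (inord k : 'I_4).
have fadj i j : i < 4 -> j < 4 -> i != j -> adj (v i) (v j).
  move=> i4 j4 nij; apply: f_adj; rewrite /= /complete_adj -val_eqE /= !inordK //.
have fneq i j : i < 4 -> j < 4 -> i != j -> v i != v j.
  by move=> i4 j4 nij; apply: adj_diff; apply: fadj.
have := pole_indep (fadj 0 1 isT isT isT); have := pole_indep (fadj 0 2 isT isT isT).
have := pole_indep (fadj 0 3 isT isT isT); have := pole_indep (fadj 1 2 isT isT isT).
have := pole_indep (fadj 1 3 isT isT isT); have := pole_indep (fadj 2 3 isT isT isT).
have := rim_matching (fadj 0 1 isT isT isT) (fadj 0 2 isT isT isT) (fneq 1 2 isT isT isT).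
have := rim_matching (fadj 0 1 isT isT isT) (fadj 0 3 isT isT isT) (fneq 1 3 isT isT isT).
have := rim_matching (fadj 0 2 isT isT isT) (fadj 0 3 isT isT isT) (fneq 2 3 isT isT isT).
have := rim_matching (fadj 1 2 isT isT isT) (fadj 1 3 isT isT isT) (fneq 2 3 isT isT isT).
by case: (pole (v 0)); case: (pole (v 1)); case: (pole (v 2)); case: (pole (v 3)).
Qed.

Lemma double_fan_no_theta6 : ~ contains double_fan theta6.
Proof.
move=> [f [f_inj f_adj]].
pose v k := f (inord k : 'I_6).
have fneq i j : i < 6 -> j < 6 -> i != j -> v i != v j.
  move=> i6 j6; apply: contraNneq => /f_inj /(congr1 val) /=.
  by rewrite !inordK // => ->.
have fadj i j : i < 6 -> j < 6 -> [|| j == i.+1 %% 6, i == j.+1 %% 6,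
    (i == 0) && (j == 3) | (i == 3) && (j == 0)] -> adj (v i) (v j).
  by move=> i6 j6 ij; apply: f_adj; rewrite /= /theta6_adj -!val_eqE /= !inordK.
have A i j := fun (i6 : i < 6) (j6 : j < 6) h => pole_indep (fadj i j i6 j6 h).
have M i j k := fun (i6 : i < 6) (j6 : j < 6) (k6 : k < 6) h h' n =>
  rim_matching (fadj i j i6 j6 h) (fadj i k i6 k6 h') (fneq j k j6 k6 n).
have Q i j k := fun (i6 : i < 6) (j6 : j < 6) (k6 : k < 6) n n' n'' =>
  pole_pigeon (fneq i j i6 j6 n) (fneq i k i6 k6 n') (fneq j k j6 k6 n'').
have := A 0 1 isT isT isT; have := A 1 2 isT isT isT; have := A 2 3 isT isT isT.
have := A 3 4 isT isT isT; have := A 4 5 isT isT isT; have := A 5 0 isT isT isT.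
have := A 0 3 isT isT isT.
have := M 0 1 5 isT isT isT isT isT isT; have := M 0 1 3 isT isT isT isT isT isT.
have := M 0 3 5 isT isT isT isT isT isT; have := M 3 2 4 isT isT isT isT isT isT.
have := M 3 0 2 isT isT isT isT isT isT; have := M 3 0 4 isT isT isT isT isT isT.
have := M 1 0 2 isT isT isT isT isT isT; have := M 2 1 3 isT isT isT isT isT isT.
have := M 4 3 5 isT isT isT isT isT isT; have := M 5 4 0 isT isT isT isT isT isT.
have := Q 0 2 4 isT isT isT isT isT isT; have := Q 1 3 5 isT isT isT isT isT isT.
case: (pole (v 0)); case: (pole (v 1)); case: (pole (v 2)); case: (pole (v 3));
  by case: (pole (v 4)); case: (pole (v 5)).
Qed.

Lemma double_fan_card : #|double_fan| = 2 * p + 2 + m.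
Proof. by rewrite card_sum card_sum !card_prod !card_ord; lia. Qed.

Lemma double_fan_edges : nb_edges double_fan = 5 * p + 2 * m.
Proof.
suff : 2 * nb_edges double_fan = 2 * (5 * p + 2 * m) by lia.
rewrite -handshake -sum1_card big_mkcond /=.
rewrite -(pair_bigA _ (fun x y : double_fan => if adj x y then 1 else 0)) /=.
have match_p (u : copies p (complete_graph 2)) : \sum_v (if copies_adj u v then 1 else 0) = 1.
  case: u => i a; pose b : 'I_2 := rev_ord a.
  rewrite -big_mkcond sum1_card; apply: (@eq_card1 _ (i, b)) => -[j c].
  rewrite !inE /= /copies_adj /complete_adj xpair_eqE /= (eq_sym j); congr (_ && _).
  rewrite -!val_eqE /=.
  by case: a c @b => [[|[|]] //= ?] [[|[|]] //= ?].
have no_m (u v : copies m (complete_graph 1)) : copies_adj u v = false.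
  case: u v => [i a] [j c]; by rewrite /= /copies_adj /complete_adj (ord1 a) (ord1 c) andbF.
have no_pole (u v : copies 2 (complete_graph 1)) : copies_adj u v = false.
  case: u v => [i a] [j c]; by rewrite /= /copies_adj /complete_adj (ord1 a) (ord1 c) andbF.
rewrite big_sumType /=.
under eq_bigr => u _.
  rewrite big_sumType /= big1 => [|v _]; last by rewrite (no_pole u v).
  rewrite sum1_card.
  over.
under [X in _ + X]eq_bigr => u _.
  rewrite big_sumType /= sum1_card.
  over.
rewrite sum_nat_const big_split /= sum_nat_const big_sumType /=.
under [X in _ + (_ + (X + _))]eq_bigr => u _.
  rewrite big_sumType /= match_p big1 //.
  over.
rewrite [X in _ + (_ + (_ + X))]big1 => [|u _]; last first.
  by rewrite big_sumType /= !big1 // => v _; rewrite (no_m u v).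
rewrite sum_nat_const !card_sum !card_prod !card_ord; lia.
Qed.

End Extremal.

(** * A drawing of the extremal graph *)

Section StraightLine.
Local Open Scope ring_scope.
Variable R : realType.

Definition segment (a b : R * R) (t : R) : R * R :=
  ((1 - t) * a.1 + t * b.1, (1 - t) * a.2 + t * b.2).

Lemma segment_continuous a b : continuous (segment a b).
Proof.
have affine (c d : R) : continuous (fun t : R => (1 - t) * c + t * d).
  move=> t; apply: cvgD; apply: cvgM; try exact: cvg_cst; try exact: cvg_id.
  by apply: cvgB; [exact: cvg_cst|exact: cvg_id].
by move=> t; exact: (cvg_pair (affine a.1 b.1 t) (affine a.2 b.2 t)).
Qed.

Lemma segment_inj a b : a != b -> injective (segment a b).
Proof.
move=> nab s t [e1 e2]; apply/eqP; rewrite -subr_eq0; apply: contraNT nab => st.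
have h c d : (1 - s) * c + s * d = (1 - t) * c + t * d -> c = d.
  move=> e; have /eqP : (s - t) * (c - d) = 0 by lra.
  by rewrite mulf_eq0 (negbTE st) subr_eq0 => /eqP.
by rewrite [a]surjective_pairing [b]surjective_pairing (h _ _ e1) (h _ _ e2).
Qed.

Lemma straight_line_planar (G : sgraph) (pos : G -> R * R) : injective pos ->
  (forall x y z t, adj x y -> 0 < t < 1 -> segment (pos x) (pos y) t <> pos z) ->
  (forall x y x' y' s t, adj x y -> adj x' y' ->
     [set x; y]%SET != [set x'; y']%SET -> 0 < s < 1 -> 0 < t < 1 ->
     segment (pos x) (pos y) s <> segment (pos x') (pos y') t) ->
  planar R G.
Proof.
move=> pos_inj avoid cross; exists pos, (fun x y => segment (pos x) (pos y)); split=> //.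
- move=> x y xy; split.
  + exact/continuous_subspaceT/segment_continuous.
  + move=> s t _ _; apply: segment_inj; rewrite (inj_eq pos_inj).
    exact: adj_diff xy.
  + by rewrite /segment subr0 !mul1r !mul0r !addr0 -surjective_pairing.
  + by rewrite /segment subrr !mul1r !mul0r !add0r -surjective_pairing.
- by move=> x y _ t _; rewrite /segment; congr pair; ring.
- by move=> x y z xy t; rewrite in_itv; apply: avoid.
- by move=> x y x' y' xy xy' ne s t; rewrite !in_itv; apply: cross.
Qed.

Variables p m : nat.
Local Notation G := (double_fan p m).

(** The poles are (0, 1) and (0, -1); the other vertices are (1, 0), (2, 0), ..., the
    matching joining an odd abscissa to the next one. *)
Definition height (s : 'I_2) : R := if s == ord0 then 1 else -1.

Definition rim_index (v : ('I_p * 'I_2) + ('I_m * 'I_1)) : nat :=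
  match v with
  | inl (i, a) => (2 * i + a).+1
  | inr (j, _) => (2 * p + j).+1
  end.

Definition fan_pos (x : G) : R * R :=
  match x with
  | inl (s, _) => (0, height s)
  | inr v => ((rim_index v)%:R, 0)
  end.

(** A description of the inner points of the segment of the edge xy that does not
    depend on its orientation, so that avoidance and disjointness can be read off
    from the coordinates. *)
Definition on_edge (x y : G) (q : R * R) : Prop :=
  match x, y with
  | inl (s, _), inr v | inr v, inl (s, _) =>
      0 < height s * q.2 < 1 /\ q.1 = (rim_index v)%:R * (1 - height s * q.2)
  | inr v, inr w => q.2 = 0 /\ exists2 k : nat, k%:R < q.1 < k.+1%:R &
      (rim_index v = k /\ rim_index w = k.+1) \/ (rim_index v = k.+1 /\ rim_index w = k)
  | inl _, inl _ => False
  end.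

Lemma height_sqr s : height s * height s = 1.
Proof. by rewrite /height; case: ifP => _; rewrite ?mulrNN mulr1. Qed.

Lemma height_eq s s' y : 0 < height s * y -> 0 < height s' * y -> s = s'.
Proof.
by rewrite /height; case: s s' => [[|[|]] //= ?] [[|[|]] //= ?];
  rewrite ?mul1r ?mulN1r => h1 h2; try (exact: val_inj); exfalso; lra.
Qed.

Lemma rim_index_inj : injective rim_index.
Proof.
move=> [[i a]|[j b]] [[i' a']|[j' b']] /= [e].
- have [ei ea] : i = i' /\ a = a'.
    by split; apply: val_inj => /=; move: e (ltn_ord a) (ltn_ord a'); clear; lia.
  by rewrite ei ea.
- by exfalso; move: e (ltn_ord i) (ltn_ord a); clear; lia.
- by exfalso; move: e (ltn_ord i') (ltn_ord a'); clear; lia.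
by move/addnI: e => /val_inj ->; rewrite (ord1 b) (ord1 b').
Qed.

Lemma fan_pos_inj : injective fan_pos.
Proof.
have h0 s : height s != 0 by rewrite /height; case: ifP; rewrite ?oppr_eq0 oner_eq0.
move=> [[s a]|v] [[s' a']|w] /= [].
- move=> e; rewrite (ord1 a) (ord1 a'); congr (inl (_, _)).
  by apply: (@height_eq _ _ (height s')); rewrite -?e height_sqr.
- by move=> _ /eqP; rewrite (negbTE (h0 s)).
- by move=> _ /esym/eqP; rewrite (negbTE (h0 s')).
by move=> /eqP; rewrite eqr_nat => /eqP /rim_index_inj ->.
Qed.

Lemma segment_on_edge (x y : G) t : adj x y -> 0 < t < 1 ->
  on_edge x y (segment (fan_pos x) (fan_pos y) t).
Proof.
case: x y => [[s a]|v] [[s' a']|w] /=.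
- by rewrite /copies_adj /complete_adj /= (ord1 a) (ord1 a') andbF.
- move=> _ t01; have hs := height_sqr s.
  have e : height s * ((1 - t) * height s + t * 0) = 1 - t by rewrite mulr0 addr0 mulrCA hs mulr1.
  by rewrite e; split; [lra|ring].
- move=> _ t01; have hs := height_sqr s'.
  have e : height s' * ((1 - t) * 0 + t * height s') = t by rewrite mulr0 add0r mulrCA hs mulr1.
  by rewrite e; split; [lra|ring].
case: v w => [[i a]|[j b]] [[i' a']|[j' b']] //=; rewrite /copies_adj /complete_adj /=; last first.
  by rewrite (ord1 b) (ord1 b') andbF.
move=> /andP[/eqP <-] naa t01; split; first by ring.
exists (2 * i).+1.
  rewrite -!natr1; case: a a' naa => [[|[|]] //= ?] [[|[|]] //= ?] _;
  by rewrite ?addn0 ?addn1 -?natr1; lra.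
by case: a a' naa => [[|[|]] //= ?] [[|[|]] //= ?] _; rewrite ?addn0 ?addn1; [left|right].
Qed.

Lemma nat_between (k l : nat) (q : R) : k%:R < q < k.+1%:R -> l%:R < q < l.+1%:R -> k = l.
Proof.
move=> /andP[k1 k2] /andP[l1 l2]; apply/eqP; rewrite eqn_leq -!(ltnS k) -!(ltnS l).
by rewrite -!(ltr_nat R) (lt_trans k1 l2) (lt_trans l1 k2).
Qed.

Lemma on_edge_avoid (x y z : G) q : on_edge x y q -> q <> fan_pos z.
Proof.
have pole_edge s (v : ('I_p * 'I_2) + ('I_m * 'I_1)) : 0 < height s * q.2 < 1 -> q <> fan_pos z.
  move=> h e; move: h; rewrite e; case: z e => [[s' a]|w] _ /=; last by rewrite mulr0 ltxx.
  by rewrite /height; do 2![case: ifP => _]; lra.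
case: x y => [[s a]|v] [[s' a']|w] //=; [case=> h _|case=> h _|].
- exact: pole_edge w h.
- exact: pole_edge v h.
case=> q2 [k kq _] e; move: q2 kq; rewrite e; case: z {pole_edge} e => [[s a]|u] _ /=.
  by move=> h0; have := height_sqr s; rewrite h0 mul0r => /esym/eqP; rewrite oner_eq0.
by move=> _; rewrite !ltr_nat ltnS => /andP[/leq_trans h /h]; rewrite ltnn.
Qed.

Lemma on_edge_cross (x y x' y' : G) q : on_edge x y q -> on_edge x' y' q ->
  [set x; y]%SET = [set x'; y']%SET.
Proof.
have flip s (v : ('I_p * 'I_2) + ('I_m * 'I_1)) : 0 < height s * q.2 < 1 -> q.2 <> 0.
  by move=> /andP[+ _] e; rewrite e mulr0 ltxx.
have same s s' v v' :
    0 < height s * q.2 < 1 -> 0 < height s' * q.2 < 1 ->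
    q.1 = (rim_index v)%:R * (1 - height s * q.2) ->
    q.1 = (rim_index v')%:R * (1 - height s' * q.2) ->
    [/\ forall a, inl (s', a) = inl (s', ord0) :> G,
      forall a, inl (s, a) = inl (s', ord0) :> G & v = v'].
  move=> h h' e; have {h'} <- : s = s' by case/andP: h h' => h _ /andP[h' _]; apply: height_eq h h'.
  have all1 a : inl (s, a) = inl (s, ord0) :> G by rewrite (ord1 a).
  rewrite e; have n0 : 1 - height s * q.2 != 0.
    by rewrite subr_eq0 eq_sym lt_eqF //; case/andP: h.
  by move=> /(mulIf n0) /eqP; rewrite eqr_nat => /eqP /rim_index_inj ->.
case: x y => [[s a]|v] [[s1 a1]|w]; case: x' y' => [[s' a']|v'] [[s1' a1']|w'] //=;
  try by move=> [h e] [h' e']; have [ea' ea ->] := same _ _ _ _ h h' e e';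
    rewrite ea' ea // setUC.
- by move=> [h _] [q2 _]; case: (flip _ w h q2).
- by move=> [h _] [q2 _]; case: (flip _ v h q2).
- by move=> [q2 _] [h _]; case: (flip _ w' h q2).
- by move=> [q2 _] [h _]; case: (flip _ v' h q2).
move=> [_ [k kq kE]] [_ [k' kq' kE']]; have ekk' := nat_between kq kq'; subst k'.
have inj := rim_index_inj.
case: kE kE' => -[e1 e2] [] [e1' e2'].
- by have [-> ->] : v = v' /\ w = w' by split; apply: inj; congruence.
- have [-> ->] : v = w' /\ w = v' by split; apply: inj; congruence.
  exact: setUC.
- have [-> ->] : v = w' /\ w = v' by split; apply: inj; congruence.
  exact: setUC.
- by have [-> ->] : v = v' /\ w = w' by split; apply: inj; congruence.
Qed.

Theorem double_fan_planar : planar R G.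
Proof.
apply: (straight_line_planar fan_pos_inj) => [x y z t xy t01|x y x' y' s t xy xy' ne s01 t01 e].
  exact: on_edge_avoid (segment_on_edge xy t01).
case/eqP: ne; apply: on_edge_cross (segment_on_edge xy s01) _.
by rewrite e; apply: segment_on_edge.
Qed.

End StraightLine.

Theorem theorem1p6 (R : realType) (n p m : nat)
    (hn : 6 <= n) (hp : 2 <= p) (hm : 0 <= m <= 1) (hnpm : n = 2 * p + 2 + m) :
  let F : sgraph -> Prop :=
    fun H => H = complete_graph 4 \/ H = theta6 in
  let G : sgraph :=
    join (copies 2 (complete_graph 1))
         (disjoint_union (copies p (complete_graph 2))
                         (copies m (complete_graph 1))) in
  ex_planar R n F = (5 * (n - 2)) %/ 2 /\
  [/\ #|G| = n, planar R G, free_of F G & nb_edges G = (5 * (n - 2)) %/ 2].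
Proof.
move=> F G.
have G_card : #|G| = n by rewrite hnpm; apply: double_fan_card.
have G_planar : planar R G by apply: double_fan_planar.
have G_free : free_of F G.
  by move=> H [->|->]; [apply: double_fan_no_K4|apply: double_fan_no_theta6].
have G_edges : nb_edges G = (5 * (n - 2)) %/ 2.
  by rewrite (double_fan_edges p m) hnpm; move: hm; lia.
split=> //; apply/eqP; rewrite eqn_leq; apply/andP; split.
  apply/bigmax_leqP => k /asboolP[H [cH plH frH <-]]; rewrite -cH.
  apply: (planar_edge_bound plH); rewrite ?cH //; apply: frH; [by left|by right].
have lt_K : (5 * (n - 2)) %/ 2 < 'C(n, 2).+1.
  by rewrite bin2; move: hn; nia.
apply: (bigop.bigmax_sup (Ordinal lt_K)) => //; apply/asboolP; by exists G.
Qed.
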